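(* The function $\frac{\log n}{n}$ is a sharp threshold for the property that a fixed ordered pair of distinct vertices $(v,u)$ admits a temporal $(v,u)$-path. More specifically, let $\varepsilon(n)=\frac{3(\log n)^{0.8}}{n}$. There is $N$ such that for all $n\ge N$, all $p\in[0,1]$ and any two fixed distinct vertices $v,u$ of $\mathcal G\sim\mathcal F_{n,p}$: (i) if $p<\frac{\log n}{n}-\varepsilon(n)$, then with probability at least $1-\frac{6}{\log n}$ there is no temporal $(v,u)$-path in $\mathcal G$; (ii) if $p>\frac{\log n}{n}+\varepsilon(n)$, then with probability at least $1-\frac{6}{\log n}$ there is a temporal $(v,u)$-path in $\mathcal G$.
   Context: A simple temporal graph is a pair $(G,\lambda)$ where $G=(V,E)$ is a finite simple undirected graph and $\lambda:E\to\mathbb R$ assigns a single time label to each edge. A temporal $(u,v)$-path is a path $u=u_0,u_1,\dots,u_\ell=v$ in $G$ with $\lambda(u_0u_1)\le\lambda(u_1u_2)\le\dots\le\lambda(u_{\ell-1}u_\ell)$. For $n\in\mathbb N$ and $p\in[0,1]$, the random simple temporal graph model $\mathcal F_{n,p}$ is defined as follows: draw $G$ from the Erdős–Rényi model $G_{n,p}$ on $n$ labelled vertices, and assign to each edge of $G$ an independent time label uniformly distributed in $[0,1]$. Here $\log$ is the natural logarithm. A property holds asymptotically almost surely (a.a.s.) if its probability tends to $1$ as $n\to\infty$. A function $p=p(n)$ is a sharp threshold for a property $\mathcal P$ if for every $\varepsilon>0$, a random temporal graph from $\mathcal F_{n,(1-\varepsilon)p}$ a.a.s. does not have $\mathcal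 P$, while one from $\mathcal F_{n,(1+\varepsilon)p}$ a.a.s. has $\mathcal P$. *)

(* Defs.v *)
From HB Require Import structures.
From mathcomp Require Import all_boot all_order all_algebra.
From mathcomp Require Import all_classical all_reals all_analysis.

Set Implicit Arguments.
Unset Strict Implicit.
Unset Printing Implicit Defensive.

Import Order.TTheory GRing.Theory Num.Theory.
Import numFieldNormedType.Exports.

Local Open Scope classical_set_scope.
Local Open Scope ring_scope.

(* An undirected edge xy is the two-element set [set x; y].  The labelling is
   a total function on sets of vertices; only its values on edges are ever
   used. *)
Record temporal_graph (R : realType) (n : nat) := TemporalGraph {
  tg_edges : {set {set 'I_n}};
  tg_label : {set 'I_n} -> R;
  tg_edgesP : forall e, e \in tg_edges -> #|e| = 2%N
}.

Definition tg_adj (R : realType) (n : nat) (G : temporal_graph R n) :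
    rel 'I_n :=
  fun x y => [set x; y]%SET \in tg_edges G.

Definition has_temporal_path (R : realType) (n : nat) (G : temporal_graph R n)
    (x y : 'I_n) : Prop :=
  exists s : seq 'I_n,
    [/\ path (tg_adj G) x s, last x s = y, uniq (x :: s) &
        sorted <=%R (pairmap (fun a b => tg_label G [set a; b]%SET) x s)].

(* The event that the edge set is E and every edge e of E has label in B e. *)
Definition edges_labels_event (R : realType) (n : nat) (T : Type)
    (G : T -> temporal_graph R n) (E : {set {set 'I_n}})
    (B : {set 'I_n} -> set R) : set T :=
  [set w | tg_edges (G w) = E /\ forall e, e \in E -> B e (tg_label (G w) e)].

(* The random temporal graph G, defined on the probability space (T, P), is
   distributed as F_{n,p}.  In order: G is measurable; its edge set has the
   Erdos-Renyi law, each of the 'C(n, 2) pairs being an edge independently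
   with probability p; conditionally on the edge set, the labels of the edges
   are independent and uniform in [0, 1]. *)
Definition is_Fnp (R : realType) (n : nat) (p : R) (d : measure_display)
    (T : measurableType d) (P : probability T R)
    (G : T -> temporal_graph R n) : Prop :=
  [/\ 0 <= p <= 1,
      forall E (B : {set 'I_n} -> set R), (forall e, measurable (B e)) ->
        measurable (edges_labels_event G E B),
      forall E : {set {set 'I_n}}, (forall e, e \in E -> #|e| = 2%N) ->
        P [set w | tg_edges (G w) = E] =
        (p ^+ #|E| * (1 - p) ^+ ('C(n, 2) - #|E|))%:E &
      forall E (B : {set 'I_n} -> set R), (forall e, measurable (B e)) ->
        P (edges_labels_event G E B) =
        (P [set w | tg_edges (G w) = E] *
         \prod_(e in E) uniform_prob (@ltr01 R) (B e))%E].

Lemma measurable_forall_in (d : measure_display) (T : measurableType d) (I : eqType)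
  (s : seq I) (F : I -> set T) : (forall i, measurable (F i)) ->
  measurable [set w | forall i, i \in s -> F i w].
Proof.
move=> mF; elim: s => [|a s IH].
  by rewrite (_ : [set _ | _] = setT) //; apply/seteqP; split => // w _ i.
rewrite (_ : [set _ | _] = F a `&` [set w | forall i, i \in s -> F i w]).
  exact: measurableI.
apply/seteqP; split => w /= H.
  by split=> [|i iin]; apply: H; rewrite inE ?eqxx// iin orbT.
by move=> i; rewrite inE => /orP[/eqP ->|]; [case: H | apply: H.2].
Qed.

Lemma indep_family (R : realType) (dX : measure_display) (X : measurableType dX)
  (m : probability X R) (I : eqType) (s : seq I) : uniq s ->
  exists (d : measure_display) (T : measurableType d) (P : probability T R)
    (Y : I -> T -> X), (forall i, measurable_fun setT (Y i)) /\
   forall B : I -> set X, (forall i, measurable (B i)) ->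
     P [set w | forall i, i \in s -> B i (Y i w)] = (\prod_(i <- s) m (B i))%E.
Proof.
elim: s => [_|a s IH /= /andP[aNs us]].
  exists dX, X, m, (fun _ => id); split; first by move=> i; exact: measurable_id.
  move=> B mB; rewrite big_nil (_ : [set _ | _] = setT) ?probability_setT//.
  by apply/seteqP; split => // w _ i.
have [d [T [P [Y [mY HY]]]]] := IH us.
exists _, (X * T)%type, (m \x P)%E,
  (fun i (w : X * T) => if i == a then w.1 else Y i w.2); split.
  move=> i; case: (i == a); first exact: measurable_fst.
  exact: (measurableT_comp (mY i) measurable_snd).
move=> B mB; rewrite big_cons -HY// -product_measure1E//; last first.
  by apply: (@measurable_forall_in _ _ _ _ (fun i => Y i @^-1` B i)) => i; rewrite -[X in measurable X]setTI; exact: mY.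
congr (_ _); apply/seteqP; split => -[x w] /= H.
  split=> [|i ins]; first by have := H a (mem_head _ _); rewrite eqxx.
  have := H i; rewrite inE ins orbT => /(_ isT).
  by case: eqP => [ia|//]; rewrite ia (negPf aNs) in ins.
move=> i; rewrite inE; case: eqP => [-> _|_ /= ins]; first by case: H.
by case: H => _; apply.
Qed.

(* Every F_{n,p} with p in [0, 1] is realized by some random temporal graph. *)
Lemma Fnp_exists (R : realType) (n : nat) (p : R) : 0 <= p <= 1 ->
  exists (d : measure_display) (T : measurableType d) (P : probability T R)
    (G : T -> temporal_graph R n), is_Fnp p P G.
Proof.
move=> p01.
pose U : probability _ R := uniform_prob (@ltr01 R).
pose b : probability bool R := bernoulli_prob p.
pose K := [set e : {set 'I_n} | #|e| == 2]%SET.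
have [d [T [P [Y [mY HY]]]]] := indep_family (b \x U)%E (enum_uniq K).
pose S w := [set e in K | (Y e w).1]%SET.
have SP w e : e \in S w -> #|e| = 2%N by rewrite !inE => /andP[/eqP].
pose G w := TemporalGraph (fun e => (Y e w).2 : R) (@SP w).
pose C (E : {set {set 'I_n}}) (B : {set 'I_n} -> set R) e : set (bool * R) :=
  if e \in E then [set true] `*` B e else [set false] `*` setT.
have mC E (B : {set 'I_n} -> set R) : (forall e, measurable (B e)) -> forall e, measurable (C E B e).
  by move=> mB e; rewrite /C; case: ifP => _; apply: measurableX.
have evE (E : {set {set 'I_n}}) B : E \subset K -> edges_labels_event G E B =
   [set w | forall e, e \in enum K -> C E B e (Y e w)].
  move=> EK; apply/seteqP; split => w /=.
    move=> [/= SE HB] e; rewrite mem_enum => eK.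
    rewrite /C; case: ifPn => eE.
      split; last exact: HB.
      by move: eE; rewrite -SE inE => /andP[].
    split => //=; move: eE; rewrite -SE inE eK /=.
    by case: (Y e w).1.
  move=> H; have SE : S w = E.
    apply/setP => e; rewrite inE; case: (boolP (e \in K)) => eK /=; last first.
      by apply/esym/negbTE; apply: contra eK; exact: (fintype.subsetP EK).
    have := H e; rewrite mem_enum eK => /(_ isT); rewrite /C.
    by case: ifP => _ [/= -> _].
  split => // e eE; have := H e; rewrite mem_enum (fintype.subsetP EK _ eE) => /(_ isT).
  by rewrite /C eE => -[].
have ev0 (E : {set {set 'I_n}}) B : ~~ (E \subset K) -> edges_labels_event G E B = set0.
  move=> EK; apply/seteqP; split => w //= [/= SE _]; move: EK; rewrite -SE.
  by move/negP; apply; apply/fintype.subsetP => e; rewrite inE => /andP[].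
have evT E : [set w | tg_edges (G w) = E] = edges_labels_event G E (fun=> setT : set R).
  by apply/seteqP; split => w /=; [split|case].
have bt : b [set true] = p%:E.
  rewrite (_ : b _ = bernoulli_prob p [set true])// bernoulli_probE// !diracE.
  by rewrite mem_set// memNset// mule1 mule0 adde0.
have bf : b [set false] = (1 - p)%:E.
  rewrite (_ : b _ = bernoulli_prob p [set false])// bernoulli_probE// !diracE.
  by rewrite memNset// mem_set// mule1 mule0 add0e.
have PE (E : {set {set 'I_n}}) B : E \subset K -> (forall e, measurable (B e)) ->
  P (edges_labels_event G E B) =
   ((p ^+ #|E| * (1 - p) ^+ ('C(n, 2) - #|E|))%:E * \prod_(e in E) U (B e))%E.
  move=> EK mB; rewrite evE// HY; last exact: mC.
  rewrite big_enum/= (big_setID E)/=.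
  have -> : (K :&: E = E)%SET by apply/finset.setIidPr.
  rewrite (eq_bigr (fun e => p%:E * U (B e))%E); last first.
    move=> e eE; rewrite /C eE; rewrite product_measure1E; [congr (_ * _)%E; exact: bt|by []|exact: mB].
  rewrite big_split/=.
  rewrite [X in (_ * X)%E](eq_bigr (fun=> (1-p)%:E)); last first.
    move=> e; rewrite inE => /andP[eE _].
    rewrite /C (negPf eE); rewrite product_measure1E; [|by []|exact: measurableT]; rewrite -[RHS]mule1; congr (_ * _)%E; first exact: bf.
    exact: (@probability_setT _ _ _ U).
  rewrite !prodEFin !prodr_const cardsD (finset.setIidPr EK) card_draws card_ord.
  by rewrite EFinM -!muleA; congr (_ * _)%E; rewrite muleC.
exists d, T, P, G; split => //.
- move=> E B mB; case: (boolP (E \subset K)) => EK; last by rewrite ev0.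
  rewrite evE//; apply: (@measurable_forall_in _ _ _ _ (fun e => Y e @^-1` C E B e)) => i.
  by rewrite -[X in measurable X]setTI; apply: mY => //; exact: mC.
- move=> E E2; rewrite evT PE//.
    rewrite big1 ?mule1// => e _; exact: probability_setT.
  by apply/fintype.subsetP => e /E2; rewrite inE => ->.
- move=> E B mB; rewrite evT; case: (boolP (E \subset K)) => EK.
    rewrite !PE//; congr (_ * _)%E; rewrite [X in (_ * X)%E]big1 ?mule1// => e _.
    exact: probability_setT.
  by rewrite !ev0// measure0 mul0e.
Qed.
(* G ~ F_{n,q(n)} a.a.s. satisfies Q.  The probability of Q only depends on
   the law of G, so convergence to 1 is stated uniformly over all realizations
   of F_{n,q(n)}.  The model is undefined, and nothing is required, at those n
   for which q(n) is outside [0, 1]. *)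
Definition aas (R : realType) (q : nat -> R)
    (Q : forall n, temporal_graph R n -> Prop) : Prop :=
  forall delta : R, 0 < delta ->
  \forall n \near \oo,
  forall (d : measure_display) (T : measurableType d) (P : probability T R)
    (G : T -> temporal_graph R n), is_Fnp (q n) P G ->
  ((1 - delta)%:E <= P [set w | Q n (G w)])%E.

Definition sharp_threshold (R : realType) (p : nat -> R)
    (Q : forall n, temporal_graph R n -> Prop) : Prop :=
  forall eps : R, 0 < eps ->
  aas (fun n => (1 - eps) * p n) (fun n G => ~ Q n G) /\
  aas (fun n => (1 + eps) * p n) Q.

(* The vertices of F_{n,p} are 0, ..., n - 1; naming the endpoints by natural
   numbers lets a pair of vertices be fixed along varying n. *)
Definition pair_has_temporal_path (R : realType) (v u : nat -> nat) (n : nat)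
    (G : temporal_graph R n) : Prop :=
  exists x y : 'I_n,
    [/\ x = v n :> nat, y = u n :> nat & has_temporal_path G x y].

Definition eps_n (R : realType) (n : nat) : R :=
  3 * (ln n%:R `^ (4 / 5)) / n%:R.

(* Main.v *)
(** Below the threshold: at most [n ^ k] paths from [v] to [u] have [k + 1] edges,
    each of them is temporal with probability [p ^ (k + 1) / (k + 1)!], so the
    expected number of temporal paths is at most [exp (n p) / n].  The factor
    [1 / (k + 1)!] is obtained up to a constant by cutting [0, 1] into [n ^ 2 + 1]
    cells and counting weakly increasing sequences of cells.

    Above the threshold: cut the time into [n] short windows and a last longer one,
    and let the set of reached vertices make one hop per window.  Since an edge is
    used at most once, giving every pair an independent label in each window does
    not increase the probability of reaching [u], and it makes the reached set a
    Markov chain.  Going backwards in time, the probability that a small set [S]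
    does not reach [u] stays below [z ^ #|S|], up to the error made on large sets;
    one window of density [h] multiplies [1 / z - 1] by about [1 + h n].  So
    [1 / z - 1] grows from [(ln n) ^ (4/5) / n] by a factor of about [exp (n p)]. *)

Require Import Defs.
From HB Require Import structures.
From mathcomp Require Import all_boot all_order all_algebra.
From mathcomp Require Import all_classical all_reals all_analysis.
From mathcomp Require Import ring lra.

Set Implicit Arguments.
Unset Strict Implicit.
Unset Printing Implicit Defensive.

Import Order.TTheory GRing.Theory Num.Theory.
Import numFieldNormedType.Exports.

Local Open Scope ring_scope.

Lemma le_of_eq (d : Order.disp_t) (T : porderType d) (x y : T) :
  x = y -> (x <= y)%O.
Proof. by move->. Qed.

(** * Comparison of expectations under two product laws *)

Section product_comparison.
Variables (R : numDomainType) (K W : finType).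
Implicit Types (A : {ffun K -> W}) (e : K) (x : W).

Definition upd A e x : {ffun K -> W} := [ffun e' => if e' == e then x else A e'].

Lemma upd_same A e x : upd A e x e = x.
Proof. by rewrite ffunE eqxx. Qed.

(** Every function arises exactly once by overwriting at [e] a function normalized to the value [x0]
    there. *)
Lemma sum_ffun_split e (x0 : W) (F : {ffun K -> W} -> R) :
  \sum_A F A = \sum_(A : {ffun K -> W} | A e == x0) \sum_x F (upd A e x).
Proof.
rewrite (partition_big (fun A => upd A e x0) (fun A : {ffun K -> W} => A e == x0)) /=; last first.
  by move=> A _; rewrite upd_same.
apply: eq_bigr => A /eqP Ae.
rewrite (reindex_onto (upd A e) (fun B => B e)) /=; last first.
  move=> B /eqP <-; apply/ffunP => e'; rewrite !ffunE.
  by case: eqP => // ->.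
apply: eq_bigl => x; rewrite upd_same eqxx andbT; apply/eqP/ffunP => e'.
by rewrite !ffunE; case: eqP => // ->.
Qed.

(* The factors are exchanged one coordinate at a time. *)
Lemma le_sum_prod (x0 : W) (mu nu : K -> W -> R) (Phi : {ffun K -> W} -> R) :
  (forall e x, 0 <= mu e x) -> (forall e x, 0 <= nu e x) ->
  (forall e A, \sum_x mu e x * Phi (upd A e x) <= \sum_x nu e x * Phi (upd A e x)) ->
  \sum_(A : {ffun K -> W}) (\prod_e mu e (A e)) * Phi A <=
  \sum_(A : {ffun K -> W}) (\prod_e nu e (A e)) * Phi A.
Proof.
move=> mu0 nu0 H.
(* Hybrid law: the coordinates in [s] already carry [nu], the others still [mu]. *)
pose kap (s : seq K) e := if e \in s then nu e else mu e.
have kap0 s e x : 0 <= kap s e x by rewrite /kap; case: ifP.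
suff main s : \sum_(A : {ffun K -> W}) (\prod_e mu e (A e)) * Phi A
    <= \sum_(A : {ffun K -> W}) (\prod_e kap s e (A e)) * Phi A.
  apply: le_trans (main (enum K)) _.
  apply/le_of_eq/eq_bigr => A _; congr (_ * _).
  by apply: eq_bigr => e _; rewrite /kap mem_enum.
elim: s => [|e s IH].
  apply/le_of_eq/eq_bigr => A _; congr (_ * _).
apply: le_trans IH _; case: (boolP (e \in s)) => es.
  apply/le_of_eq/eq_bigr => A _; congr (_ * _).
  by apply: eq_bigr => e' _; rewrite /kap inE; case: eqP => // ->; rewrite es.
have split t : \sum_(A : {ffun K -> W}) (\prod_e' kap t e' (A e')) * Phi A =
    \sum_(A : {ffun K -> W} | A e == x0) (\prod_(e' | e' != e) kap t e' (A e')) *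
       \sum_x kap t e x * Phi (upd A e x).
  rewrite (sum_ffun_split e x0); apply: eq_bigr => A _.
  rewrite mulr_sumr; apply: eq_bigr => x _.
  rewrite (bigD1 e)//= upd_same mulrCA mulrA; congr (_ * _ * _).
  by apply: eq_bigr => e' /negPf e'e; rewrite ffunE e'e.
rewrite !split; apply: ler_sum => A _.
rewrite [leRHS](_ : _ = (\prod_(e' | e' != e) kap s e' (A e')) *
       \sum_x kap (e :: s) e x * Phi (upd A e x)); last first.
  by congr (_ * _); apply: eq_bigr => e' /negPf e'e; rewrite /kap inE e'e.
apply: ler_wpM2l; first by apply: prodr_ge0.
by rewrite /kap (negPf es) mem_head; exact: H.
Qed.

End product_comparison.

Lemma sum_ffun_pair (R : nmodType) (K W1 W2 : finType)
    (F : {ffun K -> W1 * W2} -> R) :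
  \sum_C F C = \sum_(B : {ffun K -> W1}) \sum_(D : {ffun K -> W2})
     F [ffun e => (B e, D e)].
Proof.
rewrite pair_bigA /=.
rewrite (reindex (fun BD : {ffun K -> W1} * {ffun K -> W2} =>
   [ffun e => (BD.1 e, BD.2 e)])) //=.
exists (fun C : {ffun K -> W1 * W2} =>
  ([ffun e => (C e).1], [ffun e => (C e).2])) => [[B D] _|C _] /=.
  by congr pair; apply/ffunP => e; rewrite !ffunE.
by apply/ffunP => e; rewrite !ffunE; case: (C e).
Qed.

(** * Vertices reached with one hop per window *)

Section reachability.
Variable (V : finType).
Implicit Types (S : {set V}) (b : {set V} -> bool).

Definition spread S b : {set V} :=
  S :|: [set y | [exists x in S, b [set x; y]%SET]]%SET.

Lemma mem_spread S b y :
  (y \in spread S b) = (y \in S) || [exists x in S, b [set x; y]%SET].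
Proof. by rewrite !inE. Qed.

Lemma sub_spread S b : S \subset spread S b.
Proof. exact: finset.subsetUl. Qed.

Lemma eq_spread S b b' :
  (forall x y, x \in S -> y \notin S -> b [set x; y]%SET = b' [set x; y]%SET) ->
  spread S b = spread S b'.
Proof.
move=> H; apply/setP => y; rewrite !mem_spread; case: (boolP (y \in S)) => //= yS.
by apply: eq_existsb => x; case: (boolP (x \in S)) => //= xS; rewrite H.
Qed.

Variable (I : eqType).
Implicit Types (s : seq I) (D : {set V} -> option I).

Definition reach s S D : {set V} :=
  foldl (fun S i => spread S (fun e => D e == Some i)) S s.

(** The reached set only grows, so a pair inside [S] never leads to a new vertex and its window may
    be changed freely. *)
Lemma eq_reach s S D D' :
  (forall (e : {set V}) i, i \in s -> ~~ (e \subset S) -> (D e == Some i) = (D' e == Some i)) ->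
  reach s S D = reach s S D'.
Proof.
elim: s S => //= j s IH S H.
have -> : spread S (fun e => D e == Some j) = spread S (fun e => D' e == Some j).
  apply: eq_spread => x y xS yS; apply: H; first exact: mem_head.
  by apply: contra yS => /fintype.subsetP; apply; rewrite !inE eqxx orbT.
apply: IH => e i is_ eS; apply: H; first by rewrite inE is_ orbT.
by apply: contra eS => eS; apply: fintype.subset_trans eS (sub_spread _ _).
Qed.

Lemma reach_mono s S S' D D' : S \subset S' ->
  (forall e i, D e = Some i -> D' e = Some i) ->
  reach s S D \subset reach s S' D'.
Proof.
move=> + DD'; elim: s S S' => //= i s IH S S' SS'; apply: IH.
apply/fintype.subsetP => y; rewrite !mem_spread => /orP[yS|/existsP[x /andP[xS /eqP Dxy]]].
  by rewrite (fintype.subsetP SS').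
apply/orP; right; apply/existsP; exists x; rewrite (fintype.subsetP SS')//=.
exact/eqP/DD'.
Qed.

End reachability.

(** * The process in which every window draws all pairs afresh *)

Section fresh_process.
Variables (R : realFieldType) (V : finType).
Implicit Types (S : {set V}) (h : R) (B : {ffun {set V} -> bool}).

Definition ber h (b : bool) : R := if b then h else 1 - h.

(** Every subset of [V] gets a coin, not only the pairs. [spread] reads only sets of at most two
    elements, and the other coins integrate out. *)
Definition Eber h (F : {ffun {set V} -> bool} -> R) : R :=
  \sum_(B : {ffun {set V} -> bool}) (\prod_e ber h (B e)) * F B.

Lemma ber_ge0 h b : 0 <= h <= 1 -> 0 <= ber h b.
Proof. by move=> /andP[h0 h1]; case: b => //=; rewrite subr_ge0. Qed.

Lemma Eber_prod h (g : {set V} -> bool -> R) :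
  Eber h (fun B => \prod_e g e (B e)) =
  \prod_e (h * g e true + (1 - h) * g e false).
Proof.
transitivity (\sum_(B : {ffun {set V} -> bool}) \prod_e (ber h (B e) * g e (B e))).
  by apply: eq_bigr => B _; rewrite big_split.
rewrite -(bigA_distr_bigA (fun e b => ber h b * g e b)).
by apply: eq_bigr => e _; rewrite big_bool.
Qed.

Lemma Eber_cst h (c : R) : Eber h (fun=> c) = c.
Proof.
rewrite /Eber -mulr_suml -[RHS]mul1r; congr (_ * _).
rewrite -(bigA_distr_bigA (fun (e : {set V}) b => ber h b)) big1// => e _.
by rewrite big_bool /= addrC subrK.
Qed.

Lemma EberD h F G : Eber h (fun B => F B + G B) = Eber h F + Eber h G.
Proof. by rewrite /Eber -big_split; apply: eq_bigr => B _; rewrite mulrDr. Qed.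

Lemma EberZ h c F : Eber h (fun B => c * F B) = c * Eber h F.
Proof. by rewrite /Eber mulr_sumr; apply: eq_bigr => B _; rewrite mulrCA. Qed.

Lemma EberB h F G : Eber h (fun B => F B - G B) = Eber h F - Eber h G.
Proof. by rewrite /Eber -sumrB; apply: eq_bigr => B _; rewrite mulrBr. Qed.

Lemma eq_Eber h F G : F =1 G -> Eber h F = Eber h G.
Proof. by move=> FG; apply: eq_bigr => B _; rewrite FG. Qed.

Lemma le_Eber h F G : 0 <= h <= 1 -> (forall B, F B <= G B) -> Eber h F <= Eber h G.
Proof.
move=> h01 FG; apply: ler_sum => B _; apply: ler_wpM2l => //.
by apply: prodr_ge0 => e _; exact: ber_ge0.
Qed.

Lemma set2_inj_in S (Y : {set V}) : [disjoint S & Y] ->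
  {in finset.setX S Y &, injective (fun xy : V * V => [set xy.1; xy.2]%SET)}.
Proof.
move=> dSY [x y] [x' y']; rewrite !inE /= => /andP[xS yY] /andP[x'S y'Y] E.
have SY a b : a \in S -> b \in Y -> (a == b) = false.
  by move=> aS bY; apply/negbTE; apply: contraTneq aS => ->; rewrite (disjointFl dSY).
have := set21 x y; rewrite /= in E; rewrite E !inE (SY x y')// orbF => /eqP ->.
by have := set22 x y; rewrite E !inE [y == x']eq_sym (SY x' y)//= => /eqP ->.
Qed.

(** Disjointness makes the pairs between [S] and [Y] distinct, hence their coins independent. *)
Lemma Eber_no_crossing h S (Y : {set V}) : [disjoint S & Y] ->
  Eber h (fun B => \prod_(y in Y) \prod_(x in S) (~~ B [set x; y]%SET)%:R) =
  (1 - h) ^+ (#|S| * #|Y|).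
Proof.
move=> dSY.
pose C := ((fun xy : V * V => [set xy.1; xy.2]%SET) @: finset.setX S Y)%SET.
rewrite (@eq_Eber _ _ (fun B => \prod_e if e \in C then (~~ B e)%:R else 1)).
  rewrite (Eber_prod _ (fun e b => if e \in C then (~~ b)%:R else 1)).
  rewrite (eq_bigr (fun e => if e \in C then 1 - h else 1)); last first.
    by move=> e _; case: ifP => _ /=; rewrite ?mulr0 ?mulr1 ?add0r // addrC subrK.
  by rewrite -big_mkcond/= prodr_const card_in_imset ?cardsX//; exact: set2_inj_in.
move=> B; rewrite -big_mkcond/= big_imset/=; last exact: set2_inj_in.
rewrite exchange_big/= pair_big/=.
by apply: eq_bigl => -[x y]; rewrite inE.
Qed.

Lemma prod_no_crossing S B y : y \notin S ->
  \prod_(x in S) (~~ B [set x; y]%SET)%:R = (y \notin spread S B)%:R :> R.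
Proof.
move=> yS; rewrite mem_spread (negPf yS) /=.
case: (boolP [exists x in S, _]) => [/existsP[x /andP[xS Bxy]]|].
  by rewrite (bigD1 x)//= Bxy mul0r.
rewrite negb_exists => /forallP H; rewrite big1// => x xS.
by have := H x; rewrite xS /= => ->.
Qed.

(** Each vertex outside [S] is missed independently with probability [(1 - h) ^+ #|S|], and
    contributes [1] if missed and [z] if reached, that is [z + (1 - z) * c B y]. Expanding the
    product of these terms over sets [J] of missed vertices reduces the expectation to
    [Eber_no_crossing]. *)
Lemma Eber_spread_gf h z S :
  Eber h (fun B => z ^+ #|spread S B|) =
  z ^+ #|S| * (z + (1 - z) * (1 - h) ^+ #|S|) ^+ (#|V| - #|S|).
Proof.
pose c B y : R := \prod_(x in S) (~~ B [set x; y]%SET)%:R.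
(* Since [f] vanishes on [S], the expansion may run over all [J]: those meeting [S] contribute
   nothing. *)
pose f (t : R) y := if y \in S then 0 else (1 - z) * t.
pose g y := if y \in S then 1 else z.
have fgE (t : V -> R) : z ^+ #|S| * \prod_(y in ~: S) (z + (1 - z) * t y) =
    z ^+ #|S| * \sum_(J : {set V}) \prod_y (if y \in J then f (t y) y else g y).
  rewrite -bigA_distr; congr (_ * _); rewrite big_mkcond /=; apply: eq_bigr => y _.
  by rewrite inE /f /g; case: (y \in S) => /=; [rewrite add0r | rewrite addrC].
transitivity (Eber h (fun B => z ^+ #|S| *
    \prod_(y in ~: S) (z + (1 - z) * c B y))).
  apply: eq_Eber => B.
  rewrite -(cardsID S (spread S B)) (finset.setIidPr (sub_spread S B)).
  rewrite exprD; congr (_ * _).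
  rewrite -prodr_const finset.setDE finset.setIC.
  rewrite big_mkcond [RHS]big_mkcond /=; apply: eq_bigr => y _.
  rewrite finset.in_setI finset.in_setC; case: (boolP (y \in S)) => //= yS.
  rewrite /c prod_no_crossing//.
  by case: (y \in spread S B) => /=; ring.
under eq_Eber do rewrite fgE mulr_sumr.
rewrite /Eber; under eq_bigr do rewrite mulr_sumr.
rewrite exchange_big /=.
rewrite (eq_bigr (fun J : {set V} => z ^+ #|S| * \prod_y
    (if y \in J then f ((1 - h) ^+ #|S|) y else g y))); last first.
  move=> J _; case: (boolP [disjoint S & J]) => dSJ; last first.
    have [y yS yJ] : exists2 y, y \in S & y \in J.
      by move: dSJ; rewrite -finset.setI_eq0 => /finset.set0Pn[y]; rewrite inE => /andP[]; exists y.
    rewrite (bigD1 y)//= yJ /f yS mul0r mulr0 big1// => B _.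
    by rewrite (bigD1 y)//= yJ yS mul0r !mulr0.
  have JS y : y \in J -> y \in S = false by move=> yJ; apply: (disjointFl dSJ).
  pose k := z ^+ #|S| * \prod_y (if y \in J then 1 - z else g y).
  have fE (t : V -> R) : z ^+ #|S| * \prod_y (if y \in J then f (t y) y else g y) =
      k * \prod_(y in J) t y.
    rewrite /k -mulrA; congr (_ * _); rewrite [X in _ = _ * X]big_mkcond -big_split /=.
    by apply: eq_bigr => y _; case: ifP => yJ; rewrite ?mulr1// /f JS.
  rewrite fE prodr_const -exprM -(Eber_no_crossing h dSJ) -EberZ.
  by apply: eq_bigr => B _; rewrite fE.
rewrite -mulr_sumr -fgE; congr (_ * _).
by rewrite prodr_const (finset.cardsCs (~: S)) finset.setCK.
Qed.

Variable u : V.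

(* Probability that [S] reaches [u] when all pairs are drawn afresh in every window,
   with the densities [hs]. *)
Fixpoint fresh (hs : seq R) S : R :=
  if hs is h :: hs' then Eber h (fun B => fresh hs' (spread S B))
  else (u \in S)%:R.

(** No vertex of [S] is lost before the last window, and there each of them has its own chance [d]
    of being joined to [u]. *)
Lemma fresh_fail_last (hs : seq R) (d : R) S : all (fun h => 0 <= h <= 1) hs -> 0 <= d <= 1 ->
  1 - fresh (rcons hs d) S <= (1 - d) ^+ #|S|.
Proof.
move=> + /andP[d0 d1]; elim: hs S => [|h hs IH] S /=.
  move=> _; case: (boolP (u \in S)) => uS.
    rewrite (@eq_Eber _ _ (fun=> 1)) ?Eber_cst ?subrr ?exprn_ge0 ?subr_ge0//.
    by move=> B; rewrite mem_spread uS.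
  have dSu : [disjoint S & [set u]%SET].
    by rewrite disjoint_sym disjoints1.
  rewrite -[X in _ ^+ X]muln1 -(cards1 u) -(Eber_no_crossing d dSu).
  rewrite -[X in X - _](Eber_cst d 1) -EberB; apply/le_of_eq/eq_Eber => B.
  by rewrite big_set1 prod_no_crossing//; case: (u \in _); rewrite ?subrr ?subr0.
move=> /andP[h01 hs01]; rewrite -[X in X - _](Eber_cst h 1) -EberB.
apply: le_trans (le_Eber h01 (fun B => IH (spread S B) hs01)) _.
rewrite -[leRHS](Eber_cst h); apply: le_Eber => // B.
by apply: ler_wiXn2l; rewrite ?subr_ge0 ?subset_leq_card ?sub_spread// lerBlDr lerDl.
Qed.

(* [zs] bounds the failure probability of small sets, [c] that of large ones. *)
Lemma fresh_fail_iter (h d c t : R) (zs : nat -> R) k S :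
  0 <= h <= 1 -> 0 <= d <= 1 -> 0 <= c ->
  (forall j, 0 <= zs j) -> 1 - d <= zs 0%N ->
  (forall s : nat, t < s%:R -> (1 - d) ^+ s <= c) ->
  (forall j s, s%:R <= t -> (s <= #|V|)%N ->
     zs j ^+ s * (zs j + (1 - zs j) * (1 - h) ^+ s) ^+ (#|V| - s) <= zs j.+1 ^+ s) ->
  1 - fresh (rcons (nseq k h) d) S <= zs k ^+ #|S| + c.
Proof.
move=> h01 d01 c0 z0 zd Hc Hz; elim: k S => [|k IH] S.
  apply: le_trans (@fresh_fail_last [::] d S _ d01) _ => //.
  apply: le_trans (_ : zs 0%N ^+ #|S| <= _); last by rewrite lerDl.
  by apply: lerXn2r => //; rewrite nnegrE ?subr_ge0//; case/andP: d01.
(* For a set larger than [t] the last window alone suffices; a small one makes a step of the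
   generating function. *)
have [St|St] := leP #|S|%:R t; last first.
  apply: le_trans (fresh_fail_last _ _ d01) _.
    by rewrite all_nseq h01 orbT.
  by apply: le_trans (Hc _ St) _; rewrite lerDr exprn_ge0.
rewrite /= -[X in X - _](Eber_cst h 1) -EberB.
apply: le_trans (le_Eber h01 (fun B => IH (spread S B))) _.
by rewrite EberD Eber_cst lerD2r Eber_spread_gf Hz// max_card.
Qed.

End fresh_process.

(** * One label per pair against fresh draws *)

Section single_label.
Variables (R : realFieldType) (V I : finType) (h : I -> R) (u : V).
Implicit Types (S : {set V}) (s : seq I) (D : {ffun {set V} -> option I}).

(* Law of the window of a pair when only the windows in [s] are recorded. *)
Definition single s (e : {set V}) (d : option I) : R :=
  if #|e| == 2 then
    if d is Some i then (i \in s)%:R * h i else 1 - \sum_(i <- s) h i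
  else (d == None)%:R.

Lemma sum_option (F : option I -> R) : \sum_d F d = F None + \sum_i F (Some i).
Proof.
rewrite (bigD1 None)//=; congr (_ + _).
rewrite (reindex_omap Some id) /=; last by case.
by apply: eq_bigl => i; rewrite eqxx.
Qed.

Lemma sum_single s (e : {set V}) (F : option I -> R) : uniq s -> #|e| == 2 ->
  \sum_d single s e d * F d =
  (1 - \sum_(i <- s) h i) * F None + \sum_(i <- s) h i * F (Some i).
Proof.
move=> us e2; rewrite sum_option /single e2; congr (_ + _).
rewrite [RHS]big_uniq//= [RHS]big_mkcond; apply: eq_bigr => i _.
by case: (i \in s); rewrite ?mul1r ?mul0r.
Qed.

Lemma sum_single_nonpair s (e : {set V}) (F : option I -> R) :
  #|e| != 2 -> \sum_d single s e d * F d = F None.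
Proof.
move=> /negPf e2; rewrite sum_option /single e2 eqxx mul1r big1 ?addr0// => i _.
by rewrite mul0r.
Qed.

Hypothesis h0 : forall i, 0 <= h i.

Lemma single_ge0 s e d : \sum_(i <- s) h i <= 1 -> 0 <= single s e d.
Proof.
rewrite /single; case: ifP => // _ hs1; case: d => [i|]; last by rewrite subr_ge0.
exact: mulr_ge0.
Qed.

(* Once an edge has been used both its endpoints are reached, so a second label
   on it would be useless: independent labels in each window do not help. *)
Lemma fresh_le_single s S : uniq s -> \sum_(i <- s) h i <= 1 ->
  fresh u (map h s) S <=
  \sum_(D : {ffun {set V} -> option I}) (\prod_e single s e (D e)) * (u \in reach s S D)%:R.
Proof.
elim: s S => [|j s IH] S.
  move=> _ _ /=; rewrite -mulr_suml.
  rewrite -(bigA_distr_bigA (fun e d => single [::] e d)) big1 ?mul1r// => e _.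
  rewrite sum_option /single big_nil.
  by case: ifP => _; rewrite big1 ?addr0 ?subr0// => i _; rewrite mul0r.
rewrite [uniq _]/= big_cons => /andP[js us] hs1.
have hs1' : \sum_(i <- s) h i <= 1.
  by apply: le_trans hs1; rewrite lerDr.
have hj01 : 0 <= h j <= 1.
  rewrite h0 /=; apply: le_trans hs1; rewrite lerDl.
  by apply: sumr_ge0 => i _.
apply: le_trans (le_Eber hj01 (fun B => IH (spread S B) us hs1')) _.
pose Psi (C : {ffun {set V} -> bool * option I}) : R :=
  (u \in reach s (spread S (fun e => (C e).1)) (fun e => (C e).2))%:R.
have PsiE (B : {ffun {set V} -> bool}) D :
    Psi [ffun e => (B e, D e)] = (u \in reach s (spread S B) D)%:R.
  rewrite /Psi; congr (nat_of_bool (u \in (_ : {set V})))%:R.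
  rewrite (@eq_spread _ S _ B) => [|x y _ _]; last by rewrite ffunE.
  by apply: eq_reach => e i _ _; rewrite ffunE.
(* Both sides become expectations of the same [Psi] of a bit for window [j] and a later window.
   Under [mu] the two are independent; under [nu] the bit says that the only label of the pair is
   [j]. *)
pose mu (e : {set V}) (bd : bool * option I) := ber (h j) bd.1 * single s e bd.2.
pose nu (e : {set V}) (bd : bool * option I) :=
  (bd.1 == (bd.2 == Some j))%:R * single (j :: s) e bd.2.
rewrite [leLHS](_ : _ = \sum_(C : {ffun {set V} -> bool * option I})
    (\prod_e mu e (C e)) * Psi C); last first.
  rewrite sum_ffun_pair; apply: eq_bigr => B _; rewrite mulr_sumr.
  apply: eq_bigr => D _; rewrite PsiE mulrA -big_split; congr (_ * _).
  by apply: eq_bigr => e _; rewrite ffunE.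
rewrite [leRHS](_ : _ = \sum_(C : {ffun {set V} -> bool * option I})
    (\prod_e nu e (C e)) * Psi C); last first.
  rewrite sum_ffun_pair exchange_big; apply: eq_bigr => D _.
  rewrite (bigD1 [ffun e => D e == Some j])//= [X in _ = _ + X]big1 ?addr0.
    rewrite PsiE; congr (_ * _).
      by apply: eq_bigr => e _; rewrite /nu !ffunE /= eqxx mul1r.
    congr (nat_of_bool (u \in reach _ _ _))%:R.
    by apply: eq_spread => x y _ _; rewrite ffunE.
  move=> B /eqP BD; have [e Be] : exists e, B e != (D e == Some j).
    apply/existsP; apply: contra_notT BD; rewrite negb_exists => /forallP H.
    by apply/ffunP => e; rewrite ffunE; have := H e; rewrite negbK => /eqP.
  by rewrite (bigD1 e)//= /nu ffunE /= (negPf Be) !mul0r.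
apply: (le_sum_prod (false, None)).
- by move=> e bd; apply: mulr_ge0; [exact: ber_ge0|exact: single_ge0].
- by move=> e bd; apply: mulr_ge0 => //; apply: single_ge0; rewrite big_cons.
move=> e C.
have [rch rchE] : exists r : bool -> option I -> {set V}, forall b d, r b d =
    reach s (spread S (fun e' => (upd C e (b, d) e').1))
      (fun e' => (upd C e (b, d) e').2) by eexists.
(* With all other pairs frozen, success depends only on the bit and the window of [e]. *)
have [psi psiE] : exists f : bool -> option I -> R,
  forall b d, f b d = (u \in rch b d)%:R by eexists.
have psi_mono i : psi false None <= psi false (Some i).
  have /fintype.subsetP/(_ u) : rch false None \subset rch false (Some i).
    rewrite !rchE; apply: reach_mono => [|e' i'].
      rewrite (@eq_spread _ S _ (fun e' => (upd C e (false, Some i) e').1))// => x y _ _.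
      by rewrite !ffunE; case: (_ == e).
    by rewrite !ffunE; case: (e' == e).
  by rewrite !psiE; case: (u \in rch false None) => // ->.
pose cross := [exists x in S, [exists y in ~: S, e == [set x; y]%SET]].
have noncross : ~~ cross -> forall b d, psi b d = psi false d.
  move=> H b d; rewrite !psiE; congr (nat_of_bool (u \in (_ : {set V})))%:R.
  rewrite !rchE (@eq_spread _ S _ (fun e' => (upd C e (false, d) e').1)).
    by apply: eq_reach => e' i _ _; rewrite !ffunE; case: (e' == e).
  move=> x y xS yS; rewrite !ffunE; case: eqP => // exy; exfalso.
  move/negP: H; apply; apply/existsP; exists x; rewrite xS; apply/existsP; exists y.
  by rewrite inE yS exy eqxx.
(* As [j] is not among the later windows [s], recording it there is the same as recording
   nothing. *)
have psi_j : psi false (Some j) = psi false None.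
  rewrite !psiE; congr (nat_of_bool (u \in (_ : {set V})))%:R.
  rewrite !rchE (@eq_spread _ S _ (fun e' => (upd C e (false, None) e').1)).
    apply: eq_reach => e' i si _; rewrite !ffunE; case: (e' == e) => //=.
    by apply/negbTE; apply: contraNneq js => -[->].
  by move=> x y _ _; rewrite !ffunE; case: (_ == e).
(* If [e] leaves [S] and is used in window [j], both its ends are reached afterwards, so its later
   window is irrelevant. *)
have psi_cross : cross -> forall d, psi true d = psi true None.
  move=> /existsP[x /andP[xS /existsP[y /andP[yS /eqP exy]]]] d.
  rewrite !psiE; congr (nat_of_bool (u \in (_ : {set V})))%:R.
  rewrite !rchE (@eq_spread _ S _ (fun e' => (upd C e (true, None) e').1)).
    apply: eq_reach => e' i si; rewrite !ffunE; case: (e' =P e) => //= -> /negP[].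
    rewrite exy; apply/fintype.subsetP => z; rewrite finset.in_set2 => /orP[] /eqP ->.
      by rewrite mem_spread xS.
    rewrite mem_spread; apply/orP; right; apply/existsP; exists x.
    by rewrite xS ffunE -exy eqxx.
  by move=> a b _ _; rewrite !ffunE; case: (_ == e).
have cross2 : cross -> #|e| == 2.
  move=> /existsP[x /andP[xS /existsP[y /andP[yS /eqP ->]]]].
  by rewrite cards2; case: (x =P y) yS => // <-; rewrite inE xS.
rewrite [leLHS](_ : _ = \sum_b \sum_d mu e (b, d) * psi b d); last first.
  by rewrite pair_bigA; apply: eq_bigr => -[b d] _; rewrite psiE rchE.
rewrite [leRHS](_ : _ = \sum_b \sum_d nu e (b, d) * psi b d); last first.
  by rewrite pair_bigA; apply: eq_bigr => -[b d] _; rewrite psiE rchE.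
rewrite [leLHS](_ : _ = \sum_d single s e d *
    (h j * psi true d + (1 - h j) * psi false d)); last first.
  rewrite exchange_big/=.
  by apply: eq_bigr => d _; rewrite big_bool /mu /=; ring.
rewrite [leRHS](_ : _ = \sum_d single (j :: s) e d * psi (d == Some j) d); last first.
  rewrite exchange_big/=.
  by apply: eq_bigr => d _; rewrite big_bool /nu /=; case: (d == Some j) => /=; ring.
have [e2|e2] := boolP (#|e| == 2); last first.
  rewrite !sum_single_nonpair// noncross; first by apply: le_of_eq => /=; ring.
  exact: contra e2.
rewrite !sum_single// ?big_cons /=; last by rewrite js.
have -> : \sum_(i <- s) h i * psi (Some i == Some j) (Some i) =
    \sum_(i <- s) h i * psi false (Some i).
  rewrite big_seq [RHS]big_seq; apply: eq_bigr => i si.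
  by case: eqP => // -[ij]; rewrite ij (negPf js) in si.
rewrite eqxx; set H := \sum_(i <- s) h i.
have [/psi_cross tr|/noncross nc] := boolP cross; last first.
  rewrite !nc psi_j; apply: le_of_eq.
  rewrite (eq_bigr (fun i => h i * psi false (Some i))); last first.
    by move=> i _; rewrite nc; ring.
  by ring.
rewrite (tr (Some j)).
set T := \sum_(i <- s) h i * psi false (Some i).
rewrite (_ : \sum_(i <- s) h i * (h j * psi true (Some i) + _) =
    h j * psi true None * H + (1 - h j) * T); last first.
  rewrite /H /T !mulr_sumr -big_split; apply: eq_bigr => i _.
  by rewrite tr /=; ring.
(* By [psi_mono] a recorded later window can only help. The gain of [nu] over [mu] is exactly [h j]
   times the slack of this inequality. *)
have HT : H * psi false None <= T.
  by rewrite mulr_suml; apply: ler_sum => i _; apply: ler_wpM2l.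
rewrite -subr_ge0 (_ : _ - _ = h j * (T - H * psi false None)); last by ring.
by apply: mulr_ge0 => //; rewrite subr_ge0.
Qed.

End single_label.

(** * Quantitative growth of the generating function *)

Section growth.
Variable R : realType.
Implicit Types (h y z eps d x : R).

Lemma onem_exp_le h s : 0 <= h <= 1 -> (1 - h) ^+ s <= expR (- (h * s%:R)).
Proof.
move=> /andP[h0 h1]; rewrite -mulNr expRM_natr; apply: lerXn2r.
- by rewrite nnegrE subr_ge0.
- by rewrite nnegrE expR_ge0.
- exact: expR_ge1Dx.
Qed.

Lemma expRN_le_inv x : 0 <= x -> expR (- x) <= (1 + x)^-1.
Proof.
move=> x0; rewrite expRN lef_pV2 ?posrE ?expR_gt0 ?expR_ge1Dx//.
by rewrite ltr_pwDl.
Qed.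

(* In the variable [1 / z - 1] one step of the generating function is at least
   multiplication by [1 + h N (1 - 2 eps)]. *)
Lemma gf_step (N s : nat) h eps y (z := (1 + y)^-1) : 0 <= h <= 1 -> h * N%:R <= 1 ->
  0 <= eps <= 2^-1 -> 0 <= y -> (s <= N)%N -> s%:R <= N%:R * eps ->
  z ^+ s * (z + (1 - z) * (1 - h) ^+ s) ^+ (N - s) <=
  (1 + y * (1 + h * N%:R * (1 - 2 * eps)))^-1 ^+ s.
Proof.
move=> /andP[h0 h1] hN /andP[e0 e1] y0 sN sNe.
have y1 : 0 < 1 + y by rewrite ltr_pwDl.
have z0 : 0 <= z by rewrite invr_ge0 ltW.
have z1 : z <= 1 by rewrite invf_le1// lerDl.
have oz0 : 0 <= 1 - z by rewrite subr_ge0.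
have oz1 : 1 - z <= 1 by rewrite gerBl.
set a := h * s%:R.
have a0 : 0 <= a by rewrite mulr_ge0.
have ae : a <= eps.
  rewrite /a; apply: (@le_trans _ _ (h * (N%:R * eps))); first exact: ler_wpM2l.
  by rewrite mulrA ler_piMl.
pose pi := 1 - (1 - h) ^+ s.
have pi_ge : a / (1 + a) <= pi.
  have : (1 - h) ^+ s <= (1 + a)^-1.
    apply: le_trans (onem_exp_le s _) _; first by rewrite h0.
    exact: expRN_le_inv.
  have -> : a / (1 + a) = 1 - (1 + a)^-1 by field; rewrite gt_eqF// ltr_pwDl.
  by rewrite /pi; lra.
have h1s0 : 0 <= (1 - h) ^+ s by rewrite exprn_ge0// subr_ge0.
have pi01 : 0 <= pi <= 1.
  apply/andP; split; last by rewrite /pi gerBl.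
  by apply: le_trans pi_ge; rewrite divr_ge0// ltW// ltr_pwDl.
set b := h * N%:R * (1 - 2 * eps).
have b0 : 0 <= b by rewrite !mulr_ge0//; lra.
(* The right side is the expected number of newly reached vertices. It is bounded below by
   [pi >= a / (1 + a)], [N - s >= N (1 - eps)] and [(1 - 2 eps) (1 + a) <= (1 - 2 eps) (1 + eps) <=
   1 - eps]. *)
have key : b * s%:R <= pi * (N - s)%:R.
  apply: (@le_trans _ _ (a / (1 + a) * (N%:R * (1 - eps)))); last first.
    apply: ler_pM => //; first by rewrite divr_ge0// ltW// ltr_pwDl.
      by rewrite mulr_ge0//; lra.
    by rewrite natrB//; lra.
  have -> : b * s%:R = a * N%:R * (1 - 2 * eps) by rewrite /b /a; ring.
  rewrite (_ : a / (1 + a) * _ = a * N%:R * ((1 - eps) / (1 + a))); last first.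
    by field; rewrite gt_eqF// ltr_pwDl.
  apply: ler_wpM2l; first by rewrite mulr_ge0.
  rewrite ler_pdivlMr ?ltr_pwDl//.
  have : (1 - 2 * eps) * (1 + a) <= (1 - 2 * eps) * (1 + eps).
    by apply: ler_wpM2l; lra.
  by have := sqr_ge0 eps; rewrite expr2; lra.
have -> : z + (1 - z) * (1 - h) ^+ s = 1 - (1 - z) * pi by rewrite /pi; ring.
apply: (@le_trans _ _ ((z * expR (- ((1 - z) * b))) ^+ s)).
  rewrite exprMn; apply: ler_wpM2l; first exact: exprn_ge0.
  apply: le_trans (onem_exp_le _ _) _.
    by case/andP: pi01 => pi0 pi1; rewrite mulr_ge0//= mulr_ile1.
  rewrite -expRM_natr ler_expR mulNr lerN2 -[leLHS]mulrA -[leRHS]mulrA.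
  exact: ler_wpM2l.
apply: lerXn2r; rewrite ?nnegrE ?mulr_ge0 ?expR_ge0//.
  by rewrite invr_ge0 addr_ge0 ?mulr_ge0// addr_ge0.
apply: (@le_trans _ _ (z * (1 + (1 - z) * b)^-1)).
  apply: ler_wpM2l => //; apply: expRN_le_inv.
  by rewrite mulr_ge0.
(* As [(1 - z) (1 + y) = y], the two denominators are equal. *)
rewrite -invfM lef_pV2 ?posrE.
- by rewrite /z; apply: le_of_eq; field; rewrite gt_eqF.
- by rewrite mulr_gt0// ltr_pwDl// mulr_ge0.
- by rewrite ltr_pwDl// mulr_ge0// addr_ge0.
Qed.

(** Apply [fresh_fail_iter] with sets counted as small up to size [#|V| * eps]. The last window
    gives [1 - d <= (1 + d)^-1], and going back through the [k] others, [gf_step] multiplies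
    [1 / z - 1] each time by the same factor. *)
Lemma fresh_fail_le (V : finType) (u : V) (S : {set V}) h d eps k :
  0 <= h <= 1 -> 0 <= d <= 1 -> h * #|V|%:R <= 1 -> 0 <= eps <= 2^-1 ->
  (0 < #|S|)%N ->
  1 - fresh u (rcons (nseq k h) d) S <=
  (1 + d * (1 + h * #|V|%:R * (1 - 2 * eps)) ^+ k)^-1 + expR (- (d * (#|V|%:R * eps))).
Proof.
move=> h01 d01 hV e01 S0.
have /andP[h0 h1] := h01; have /andP[d0 d1] := d01; have /andP[e0 e1] := e01.
set b := 1 + h * #|V|%:R * (1 - 2 * eps).
have b0 : 0 <= b by rewrite addr_ge0// !mulr_ge0//; lra.
pose zs j := (1 + d * b ^+ j)^-1.
have db0 j : 0 <= d * b ^+ j by rewrite mulr_ge0// exprn_ge0.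
have zs0 j : 0 <= zs j by rewrite invr_ge0 addr_ge0.
apply: (@le_trans _ _ (zs k ^+ #|S| + expR (- (d * (#|V|%:R * eps))))).
  apply: (@fresh_fail_iter _ _ _ _ _ _ (#|V|%:R * eps)) => //.
  - rewrite /zs expr0 mulr1 -[leRHS]div1r ler_pdivlMr.
      by have := sqr_ge0 d; rewrite expr2; lra.
    by rewrite ltr_pwDl.
  - move=> s ts; apply: le_trans (onem_exp_le _ d01) _.
    by rewrite ler_expR lerN2 ler_wpM2l// ltW.
  - move=> j s st sV; rewrite /zs exprSr mulrA.
    exact: (gf_step h01 hV e01 (db0 j) sV st).
rewrite lerD2r -[leRHS]expr1; apply: ler_wiXn2l => //.
by rewrite invf_le1 ?lerDl// ltr_pwDl.
Qed.

Lemma expR_ge_pow x n : 0 <= x -> x ^+ n / n`!%:R <= expR x.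
Proof.
case: n => [|n] x0; first by rewrite expr0 divr1 -expR0 ler_expR.
by apply: le_trans (expR_ge1Dxn n x0); rewrite lerDr.
Qed.

(** This is [ln (1 + x) >= x / (1 + x)], which follows from [expR (- y) >= 1 - y] at
    [y = x / (1 + x)]. *)
Lemma expR_le_onep x n : 0 <= x -> expR (x * n%:R / (1 + x)) <= (1 + x) ^+ n.
Proof.
move=> x0; have x1 : 0 < 1 + x by rewrite ltr_pwDl.
rewrite mulrAC expRM_natr; apply: lerXn2r; rewrite ?nnegrE ?expR_ge0 ?(ltW x1)//.
rewrite -[leRHS]invrK -[leLHS]invrK lef_pV2 ?posrE ?invr_gt0 ?expR_gt0//.
rewrite -expRN; apply: le_trans (expR_ge1Dx _); apply: le_of_eq.
by field; rewrite gt_eqF.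
Qed.

(** Here [x] is the fifth root of [ln n]. The densities of the [n] short windows and of the last one
    add up to [(x ^+ 5 + 3 * x ^+ 4) / n], the upper end of the threshold window. *)
Lemma fresh_fail_le_ln (V : finType) (u : V) (S : {set V}) x (n := #|V|) :
  32 <= x -> ln n%:R = x ^+ 5 -> (0 < n)%N -> (0 < #|S|)%N ->
  let d := x ^+ 4 / n%:R in let h := (x ^+ 5 + 2 * x ^+ 4) / (n%:R * n%:R) in
  [/\ 0 <= d <= 1, 0 <= h <= 1 &
      1 - fresh u (rcons (nseq n h) d) S <= 2 / ln n%:R].
Proof.
move=> x32 lnn n0 S0 d h; set L := ln n%:R in lnn *.
have nR0 : 0 < n%:R :> R by rewrite ltr0n.
have nE : n%:R = expR L by rewrite /L lnK// posrE.
have xp : 0 < x by lra.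
have x0 := ltW xp.
have xS j : x ^+ j * 32 <= x ^+ j.+1 by rewrite exprSr ler_wpM2l// exprn_ge0.
have x1_ge1 j : 1 <= x ^+ j by rewrite exprn_ege1//; lra.
have L0 : 0 <= L by rewrite lnn exprn_ge0.
have n_ge : 9 * x ^+ 10 <= n%:R.
  rewrite nE; apply: le_trans (expR_ge_pow 3 L0); rewrite lnn -!exprM/=.
  rewrite (_ : 3`! = 6)// ler_pdivlMr//.
  have := xS 10%N; have := xS 11%N; have := xS 12%N; have := xS 13%N; have := xS 14%N.
  by have := x1_ge1 10%N; lra.
have t_le : x ^+ 5 + 2 * x ^+ 4 <= n%:R.
  have := xS 4%N; have := xS 5%N; have := xS 6%N; have := xS 7%N; have := xS 8%N.
  have := xS 9%N; have := x1_ge1 4%N; lra.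
have x40 : 0 <= x ^+ 4 by rewrite exprn_ge0.
have x50 : 0 <= x ^+ 5 by rewrite exprn_ge0.
have d01 : 0 <= d <= 1.
  by rewrite /d divr_ge0 ?(ltW nR0)//= ler_pdivrMr// mul1r; lra.
have hn : h * n%:R = (x ^+ 5 + 2 * x ^+ 4) / n%:R.
  by rewrite /h; field; rewrite gt_eqF.
have hn1 : h * n%:R <= 1 by rewrite hn ler_pdivrMr// mul1r.
have h0 : 0 <= h by rewrite /h divr_ge0// ?mulr_ge0// ?(ltW nR0)//; lra.
have h01 : 0 <= h <= 1.
  rewrite h0 /=; apply: le_trans hn1; rewrite ler_peMr//.
  by rewrite ler1n.
split => //.
(* This [eps] costs [x ^+ 4 / 2 + x ^+ 3] in the exponent, less than the surplus [2 * x ^+ 4], while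
   the error on large sets is still only [expR (- (x ^+ 3 / 4))]. *)
pose eps := (4 * x)^-1.
have e01 : 0 <= eps <= 2^-1.
  rewrite /eps invr_ge0 mulr_ge0//= lef_pV2 ?posrE; lra.
apply: le_trans (fresh_fail_le u n h01 d01 hn1 e01 S0) _.
set t := x ^+ 5 + 3 / 2 * x ^+ 4 - x ^+ 3.
have tE : h * n%:R * (1 - 2 * eps) = t / n%:R.
  rewrite hn /eps /t; field; rewrite !gt_eqF//.
have x3 := xS 3%N; have x4 := xS 4%N; have x31 := x1_ge1 3%N.
have t0 : 0 <= t by rewrite /t; lra.
have tn0 : 0 <= t / n%:R by rewrite divr_ge0// ltW.
(* Replacing the [n]-th power by an exponential loses at most [1] in the exponent because
   [t ^ 2 <= 9 * x ^+ 10 <= n]. *)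
have tt : t - 1 <= t / n%:R * n%:R / (1 + t / n%:R).
  have -> : t / n%:R * n%:R / (1 + t / n%:R) = t * n%:R / (n%:R + t).
    by field; rewrite !gt_eqF//; lra.
  rewrite ler_pdivlMr; last by lra.
  have : t * t <= 9 * x ^+ 10.
    rewrite (_ : 9 * x ^+ 10 = (3 * x ^+ 5) * (3 * x ^+ 5)); last by ring.
    by apply: ler_pM => //; rewrite /t; lra.
  by lra.
(* The starting value [d] supplies [x ^+ 4 / n], and [expR (t - 1)] beats [n] by at least the one
   factor [x] missing to [L = x ^+ 5]. *)
have big : L <= d * (1 + h * n%:R * (1 - 2 * eps)) ^+ n.
  rewrite tE.
  apply: (@le_trans _ _ (d * expR (t - 1))); last first.
    apply: ler_wpM2l; first by case/andP: d01.
    by apply: le_trans (expR_le_onep n tn0); rewrite ler_expR.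
  have -> : d * expR (t - 1) = x ^+ 4 * expR (t - 1 - L).
    by rewrite /d nE (expRD (t - 1)) expRN; ring.
  apply: (@le_trans _ _ (x ^+ 4 * (1 + (t - 1 - L)))).
    rewrite lnn /t (exprSr _ 4); apply: ler_wpM2l => //.
    by have := xS 1%N; have := xS 2%N; rewrite expr1; lra.
  by apply: ler_wpM2l => //; exact: expR_ge1Dx.
have L1 : 0 < L by rewrite lnn exprn_gt0//; lra.
have -> : 2 / L = L^-1 + L^-1 by rewrite -mulr2n mulr_natl.
apply: lerD.
  rewrite lef_pV2 ?posrE//; last by apply: lt_le_trans L1 _; apply: le_trans big _; lra.
  by apply: le_trans big _; lra.
have -> : d * (n%:R * eps) = x ^+ 3 / 4.
  rewrite /d /eps; field; rewrite !gt_eqF//; lra.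
rewrite expRN lef_pV2 ?posrE ?expR_gt0// lnn.
apply: le_trans (expR_ge_pow 2 _); last by rewrite divr_ge0// exprn_ge0.
rewrite (_ : 2`! = 2)// exprMn -exprM /= ler_pdivlMr// exprVn.
by have := xS 5%N; lra.
Qed.

End growth.

Local Open Scope classical_set_scope.

(** * Finite unions of events and the uniform law *)

Section finite_unions.
Variables (d : measure_display) (T : measurableType d) (R : realType).
Variables (mu : {measure set T -> \bar R}).

Lemma exists2_consE (I : eqType) a (s : seq I) (F : I -> set T) :
  [set w | exists2 i, i \in a :: s & F i w] =
  F a `|` [set w | exists2 i, i \in s & F i w].
Proof.
apply/seteqP; split=> w /=.
  move=> [i]; rewrite inE => /orP[/eqP -> |si] Fi; first by left.
  by right; exists i.
case=> [Fa|[i si Fi]]; first by exists a; rewrite ?mem_head.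
by exists i; rewrite // inE si orbT.
Qed.

Lemma exists2_nilE (I : eqType) (F : I -> set T) :
  [set w | exists2 i, i \in [::] & F i w] = set0.
Proof. by apply/seteqP; split=> w // -[]. Qed.

Lemma measurable_exists2 (I : eqType) (s : seq I) (F : I -> set T) :
  (forall i, measurable (F i)) -> measurable [set w | exists2 i, i \in s & F i w].
Proof.
move=> mF; elim: s => [|a s IH]; first by rewrite exists2_nilE.
by rewrite exists2_consE; exact: measurableU.
Qed.

Lemma measure_exists2_le (I : eqType) (s : seq I) (F : I -> set T) :
  (forall i, measurable (F i)) ->
  (mu [set w | exists2 i, i \in s & F i w] <= \sum_(i <- s) mu (F i))%E.
Proof.
move=> mF; elim: s => [|a s IH]; first by rewrite exists2_nilE measure0 big_nil.
rewrite exists2_consE big_cons; apply: le_trans (leeD2l _ IH).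
by apply: measureU2 => //; exact: measurable_exists2.
Qed.

Lemma measure_exists2 (I : eqType) (s : seq I) (F : I -> set T) :
  uniq s -> (forall i, measurable (F i)) ->
  (forall i j w, F i w -> F j w -> i = j) ->
  mu [set w | exists2 i, i \in s & F i w] = (\sum_(i <- s) mu (F i))%E.
Proof.
move=> + mF tF; elim: s => [_|a s IH]; first by rewrite exists2_nilE measure0 big_nil.
move=> /= /andP[aNs us]; rewrite exists2_consE big_cons -IH// measureU//.
  exact: measurable_exists2.
apply/seteqP; split=> w //= -[Fa [i si Fi]].
by move: aNs; rewrite (tF _ _ _ Fa Fi) si.
Qed.

End finite_unions.

Section uniform01.
Variable R : realType.
Let U := uniform_prob (@ltr01 R).

Lemma uniform01_itvco (a b : R) : 0 <= a -> a <= b -> b <= 1 -> U `[a, b[ = (b - a)%:E.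
Proof.
move=> a0 ab b1; rewrite /U /uniform_prob.
rewrite (eq_integral (cst 1%E)); last first.
  move=> x; rewrite inE /= in_itv /= => /andP[ax xb].
  rewrite /uniform_pdf (le_trans a0 ax) /= (le_trans (ltW xb) b1).
  by rewrite subr0 invr1.
rewrite integral_cst//= mul1e lebesgue_measure_itv /= lte_fin.
case: ltP => [_|ba]; first by rewrite EFinB.
by rewrite (@le_anti _ _ a b) ?ab ?ba// subrr.
Qed.

Lemma uniform01_itvco01C : U (~` `[0, 1[) = 0%E.
Proof.
transitivity (1 - U `[0%R, 1%R[)%E.
  by apply: (@probability_setC _ _ _ (uniform_prob (@ltr01 R))).
by rewrite uniform01_itvco// subr0 subee.
Qed.

End uniform01.

(** * Probabilities and measurability under the law of the random graph *)

Section Fnp_law.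
Variables (R : realType) (n : nat) (p : R) (d : measure_display).
Variables (T : measurableType d) (P : probability T R) (G : T -> temporal_graph R n).
Hypothesis HG : is_Fnp p P G.
Let U := uniform_prob (@ltr01 R).
Local Notation pair_set := {set 'I_n}.
Implicit Types (e : pair_set) (E : {set pair_set}).

(* [a e] tells whether the pair [e] is allowed to be absent. *)
Definition pair_event (a : pair_set -> bool) (B : pair_set -> set R) : set T :=
  [set w | forall e, #|e| = 2 ->
     if e \in tg_edges (G w) then B e (tg_label (G w) e) else a e].

(** [is_Fnp] speaks only of events that fix the whole edge set, so the event is split according to
    it. *)
Lemma pair_eventE a B : pair_event a B =
  [set w | exists2 E, E \in enum [set E : {set pair_set} |
     [forall e, if e \in E then #|e| == 2 else (#|e| == 2) ==> a e]]%SET &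
     edges_labels_event G E B w].
Proof.
apply/seteqP; split=> w /=.
  move=> H; exists (tg_edges (G w)); last first.
    by split=> // e eE; have := H e (tg_edgesP eE); rewrite eE.
  rewrite mem_enum inE; apply/forallP => e; case: ifP => eE.
    by rewrite (tg_edgesP eE).
  by apply/implyP => /eqP/H; rewrite eE.
move=> [E]; rewrite mem_enum inE => /forallP HE [EE HB] e e2.
rewrite EE; case: ifP => eE; first exact: HB.
by have := HE e; rewrite eE e2.
Qed.

Lemma measurable_edges_labels E B : (forall e, measurable (B e)) ->
  measurable (edges_labels_event G E B).
Proof. by case: HG => _ + _ _; apply. Qed.

Lemma measurable_pair_event a B : (forall e, measurable (B e)) ->
  measurable (pair_event a B).
Proof.
by move=> mB; rewrite pair_eventE; apply: measurable_exists2 => E; exact: measurable_edges_labels.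
Qed.

Lemma pair_event_prob a (B : pair_set -> set R) (b : pair_set -> R) :
  (forall e, measurable (B e)) -> (forall e, U (B e) = (b e)%:E) ->
  P (pair_event a B) =
  (\prod_(e : pair_set | #|e| == 2) (p * b e + (1 - p) * (a e)%:R))%:E.
Proof.
move=> mB Ub; rewrite pair_eventE measure_exists2 ?enum_uniq//; last first.
- by move=> E E' w [<- _] [<- _].
- by move=> E; exact: measurable_edges_labels.
(* [f] is the weight of a present element and [g] of an absent one. Non-pairs have weights [0] and
   [1], so expanding the product of [f e + g e] leaves exactly the sum over admissible edge sets. *)
pose f (e : pair_set) := if #|e| == 2 then p * b e else 0.
pose g (e : pair_set) := if #|e| == 2 then (1 - p) * (a e)%:R else 1.
rewrite [X in X%:E](_ : _ = \prod_e (f e + g e)); last first.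
  rewrite [LHS]big_mkcond; apply: eq_bigr => e _; rewrite /f /g.
  by case: ifP => // _; rewrite add0r.
rewrite bigA_distr -sumEFin big_enum/= big_mkcond /=; apply: eq_bigr => E _.
rewrite inE; case: ifPn => [/forallP HE|]; last first.
  rewrite negb_forall => /existsP[e He]; rewrite (bigD1 e)//= /f /g.
  move: He; case: ifP => eE; case: ifP => //= _; rewrite ?mul0r// => /negPf->.
  by rewrite mulr0 mul0r.
have E2 e : e \in E -> #|e| = 2 by move=> eE; have := HE e; rewrite eE => /eqP.
case: HG => _ _ PE ->//; rewrite PE//.
rewrite (eq_bigr (fun e => (b e)%:E))//; rewrite prodEFin -EFinM; congr EFin.
rewrite [RHS](bigID (mem E)) /=.
rewrite [X in _ = X * _](eq_bigr (fun e => p * b e)); last first.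
  by move=> e eE; rewrite eE /f (E2 _ eE).
rewrite [X in _ = _ * X](eq_bigr (fun e : pair_set => if #|e| == 2 then 1 - p else 1)); last first.
  move=> e /negPf eE; rewrite eE /g; case: ifP => // e2.
  by have := HE e; rewrite eE e2 /= => ->; rewrite mulr1.
rewrite big_split /= prodr_const mulrAC; congr (_ * _).
rewrite -big_mkcondr /= prodr_const; congr (_ ^+ _).
rewrite -[n in 'C(n, _)]card_ord -card_draws -(cardsID E).
rewrite (finset.setIidPr _); last by apply/fintype.subsetP => e /E2; rewrite inE => ->.
by rewrite addKn; apply: eq_card => e; rewrite finset.in_setD inE.
Qed.

Lemma edges_present_prob (es : seq pair_set) (B : pair_set -> set R) (b : pair_set -> R) :
  uniq es -> (forall e, e \in es -> #|e| = 2) ->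
  (forall e, measurable (B e)) -> (forall e, U (B e) = (b e)%:E) ->
  let A := [set w | forall e, e \in es ->
                      e \in tg_edges (G w) /\ B e (tg_label (G w) e)] in
  measurable A /\ P A = (\prod_(e <- es) (p * b e))%:E.
Proof.
move=> ues es2 mB Ub A.
pose B' e := if e \in es then B e else setT.
have -> : A = pair_event (fun e => e \notin es) B'.
  apply/seteqP; split=> w /= H.
    move=> e e2; rewrite /B'; case: (boolP (e \in es)) => ees.
      by have [-> ] := H _ ees.
    by case: ifP.
  move=> e ees; have := H e (es2 _ ees); rewrite /B' ees /=.
  by case: ifP.
have mB' e : measurable (B' e) by rewrite /B'; case: ifP.
split; first exact: measurable_pair_event.
rewrite (@pair_event_prob _ _ (fun e => if e \in es then b e else 1))//; last first.
  by move=> e; rewrite /B'; case: ifP => // _; exact: (@probability_setT _ _ _ U).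
congr EFin; rewrite [RHS]big_uniq//= [RHS]big_mkcond [LHS]big_mkcond /=.
apply: eq_bigr => e _; case: (boolP (e \in es)) => ees /=.
  by rewrite (es2 _ ees) /= mulr0 addr0.
by case: ifP => // _; rewrite !mulr1 addrC subrK.
Qed.

(** [is_Fnp] controls labels only on edges; absent pairs get the default [0] to obtain a measurable
    function. *)
Lemma measurable_label e :
  measurable_fun setT (fun w => if e \in tg_edges (G w) then tg_label (G w) e else 0).
Proof.
move=> _ Y mY; rewrite setTI.
pose F E := if e \in E then edges_labels_event G E (fun e' => if e' == e then Y else setT)
  else if 0 \in Y then edges_labels_event G E (fun=> setT) else set0.
rewrite (_ : _ @^-1` _ = [set w | exists2 E, E \in enum {set pair_set} & F E w]).
  apply: measurable_exists2 => E; rewrite /F; case: ifP => _.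
    by apply: measurable_edges_labels => e'; case: ifP.
  by case: ifP => _ //; apply: measurable_edges_labels.
apply/seteqP; split=> w /=.
  move=> H; exists (tg_edges (G w)); first by rewrite mem_enum.
  rewrite /F; move: H; case: ifP => eE.
    by move=> Yl; split=> // e' _; case: eqP => [->|].
  by move=> Y0; rewrite mem_set.
move=> [E _]; rewrite /F; case: ifP => eE.
  by case=> -> /(_ _ eE); rewrite eqxx eE.
case: ifP => // Y0 [-> _]; rewrite eE; exact: set_mem.
Qed.

Lemma measurable_sorted (fs : seq (T -> R)) :
  (forall f, List.In f fs -> measurable_fun setT f) ->
  measurable [set w | sorted <=%R [seq f w | f <- fs]].
Proof.
elim: fs => [|f [|g fs] IH] H /=; [by rewrite (_ : [set _ | _] = setT) //; apply/seteqP..|].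
rewrite (_ : [set _ | _] = (setT `&` [set w | f w <= g w]) `&`
   [set w | sorted <=%R [seq f w | f <- g :: fs]]).
  apply: measurableI; last by apply: IH => h hin; apply: H; right.
  apply: measurable_fun_le => //; apply: H; [by left|by right; left].
by apply/seteqP; split=> w /= => [/andP[]|[[_ ->]]].
Qed.

(** For a fixed edge set and vertex sequence, being a path is a constant condition and only the
    order of the labels is random. A path without repetition has fewer than [n] edges, so the union
    is finite. *)
Lemma measurable_has_temporal_path (x y : 'I_n) :
  measurable [set w | has_temporal_path (G w) x y].
Proof.
pose lab e w := if e \in tg_edges (G w) then tg_label (G w) e else 0.
pose F E (s : seq 'I_n) : set T :=
  if [&& path (fun a b => [set a; b]%SET \in E) x s, last x s == y & uniq (x :: s)]
  then edges_labels_event G E (fun=> setT) `&`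
    [set w | sorted <=%R [seq f w | f <- pairmap (fun a b => lab [set a; b]%SET) x s]]
  else set0.
have mF E s : measurable (F E s).
  rewrite /F; case: ifP => // _; apply: measurableI; first exact: measurable_edges_labels.
  apply: measurable_sorted => f; move: (x).
  elim: s => //= b s IH a [<-|/IH//]; exact: measurable_label.
rewrite (_ : [set _ | _] = [set w | exists2 E, E \in enum {set pair_set} &
    exists2 k, k \in iota 0 n & exists2 t : k.-tuple 'I_n, t \in enum {: k.-tuple 'I_n} & F E t w]).
  apply: (@measurable_exists2 _ _ _ _ (fun E w => exists2 k, k \in iota 0 n &
    exists2 t : k.-tuple 'I_n, t \in enum {: k.-tuple 'I_n} & F E t w)) => E.
  apply: (@measurable_exists2 _ _ _ _ (fun k w =>
    exists2 t : k.-tuple 'I_n, t \in enum {: k.-tuple 'I_n} & F E t w)) => k.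
  exact: (@measurable_exists2 _ _ _ _ (fun t : k.-tuple 'I_n => F E t)).
have sortE w s a : path (tg_adj (G w)) a s ->
    [seq f w | f <- pairmap (fun a b => lab [set a; b]%SET) a s] =
    pairmap (fun a b => tg_label (G w) [set a; b]%SET) a s.
  by elim: s a => //= b s IH a /andP[ab /IH ->]; rewrite /lab; rewrite /tg_adj in ab; rewrite ab.
apply/seteqP; split=> w /=.
  move=> [s [ps ls us ss]]; exists (tg_edges (G w)); first by rewrite mem_enum.
  have sn : (size s < n)%N.
    have := max_card (mem (x :: s)); rewrite (card_uniqP us) card_ord; exact.
  exists (size s); first by rewrite mem_iota add0n leq0n.
  exists (in_tuple s); first by rewrite mem_enum.
  rewrite /F /= ls eqxx; rewrite /tg_adj in ps; rewrite ps.
  move: us => /= ->; split; first by split.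
  by rewrite /= sortE.
move=> [E _ [k _ [t _]]]; rewrite /F; case: ifP => // /and3P[pt /eqP lt ut] [[EE _] /=].
have pt' : path (tg_adj (G w)) x t by rewrite /tg_adj EE.
by rewrite sortE// => st; exists t.
Qed.

End Fnp_law.

(** * First moment of the number of temporal paths *)

Section path_edges.
Variable V : finType.
Implicit Types (a : V) (s : seq V).

Definition path_edges a s : seq {set V} := pairmap (fun x y => [set x; y]%SET) a s.

Lemma path_edges_sub a s e z : e \in path_edges a s -> z \in e -> z \in a :: s.
Proof.
elim: s a => //= b s IH a; rewrite inE => /orP[/eqP ->|/IH/[apply]].
  by rewrite !inE => /orP[] ->; rewrite ?orbT.
by rewrite !inE => ->; rewrite orbT.
Qed.

Lemma uniq_path_edges a s : uniq (a :: s) -> uniq (path_edges a s).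
Proof.
elim: s a => //= b s IH a /andP[abs ubs]; rewrite IH// andbT.
by apply: contra abs => /path_edges_sub; apply; rewrite set21.
Qed.

Lemma card_path_edges a s e : uniq (a :: s) -> e \in path_edges a s -> #|e| = 2.
Proof.
elim: s a => //= b s IH a /andP[abs ubs]; rewrite inE => /orP[/eqP ->|/IH->//].
by rewrite cards2; move: abs; rewrite inE negb_or => /andP[->].
Qed.

End path_edges.

Lemma ffact_le_expn n m : (n ^_ m <= n ^ m)%N.
Proof.
elim: m => [|m IH]; first by rewrite ffactn0 expn0.
by rewrite ffactnSr expnSr leq_mul// leq_subr.
Qed.

Lemma sum_pow_fact_le_expR (R : realType) (a : R) n : 0 <= a ->
  \sum_(k <- iota 0 n) a ^+ k.+1 / k.+1`!%:R <= expR a.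
Proof.
move=> a0.
have t0 k : 0 <= exp_coeff a k by rewrite /exp_coeff /= divr_ge0 ?exprn_ge0.
apply: (@le_trans _ _ (series (exp_coeff a) n.+1)).
  rewrite /series /= big_nat_recl// -[leLHS]add0r; apply: lerD => //.
  by rewrite /index_iota subn0.
apply: nondecreasing_cvgn_le (is_cvg_series_exp_coeff a) _.
apply/nondecreasing_seqP => k; rewrite /series /= big_nat_recr//=.
by rewrite lerDl.
Qed.

Lemma measure_exists2_leE (d : measure_display) (T : measurableType d) (R : realType)
    (mu : {measure set T -> \bar R}) (I : eqType) (s : seq I) (F : I -> set T)
    (r : I -> R) :
  (forall i, measurable (F i)) -> (forall i, i \in s -> mu (F i) <= (r i)%:E)%E ->
  (mu [set w | exists2 i, i \in s & F i w] <= (\sum_(i <- s) r i)%:E)%E.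
Proof.
move=> mF Fr; apply: le_trans (measure_exists2_le mu s mF) _.
by rewrite -sumEFin big_seq [leRHS]big_seq; apply: lee_sum.
Qed.

Section first_moment.
Variables (R : realType) (n : nat) (p : R) (d : measure_display).
Variables (T : measurableType d) (P : probability T R) (G : T -> temporal_graph R n).
Hypothesis HG : is_Fnp p P G.
Variables (v u : 'I_n) (M : nat).
Let U := uniform_prob (@ltr01 R).

Definition cell (j : 'I_M.+1) : set R := `[j%:R / M.+1%:R, j.+1%:R / M.+1%:R[.

Lemma uniform_cell j : U (cell j) = (M.+1%:R^-1)%:E.
Proof.
have M0 : 0 < M.+1%:R :> R by rewrite ltr0n.
rewrite /U uniform01_itvco.
- by congr EFin; rewrite -mulrBl -natrB// subSnn mul1r.
- by rewrite divr_ge0// ltW.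
- by rewrite ler_pM2r ?invr_gt0// ler_nat.
- by rewrite ler_pdivrMr// mul1r ler_nat.
Qed.

(** Used only for labels in [[0, 1[], where [inord] keeps the value. *)
Definition cell_of (x : R) : 'I_M.+1 := inord (Num.truncn (x * M.+1%:R)).

Lemma cell_ofE x : 0 <= x < 1 -> cell_of x = Num.truncn (x * M.+1%:R) :> nat.
Proof.
move=> /andP[x0 x1]; rewrite inordK// truncn_lt_nat ?mulr_ge0//.
by rewrite gtr_pMl// ltr0n.
Qed.

Lemma cell_ofP x : 0 <= x < 1 -> cell (cell_of x) x.
Proof.
move=> x01; rewrite /cell /= in_itv /= cell_ofE//.
rewrite ler_pdivrMr ?ltr0n// ltr_pdivlMr ?ltr0n//.
by apply: truncn_itv; rewrite mulr_ge0//; case/andP: x01.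
Qed.

Lemma cell_of_le x y : 0 <= x < 1 -> 0 <= y < 1 -> x <= y -> (cell_of x <= cell_of y)%N.
Proof.
by move=> x01 y01 xy; rewrite !cell_ofE// le_truncn// ler_wpM2r.
Qed.

Let es k (t : k.-tuple 'I_n) := path_edges v (rcons t u).

(** The tuple [t] lists the inner vertices, so there is one more edge than entries. The [uniq] guard
    makes [FP] valid for every tuple, which allows counting all [n ^ k] of them. *)
Let F k (t : k.-tuple 'I_n) (c : k.+1.-tuple 'I_M.+1) : set T :=
  if uniq (v :: rcons t u) then
    [set w | forall e, e \in es t -> e \in tg_edges (G w) /\
       cell (nth ord0 c (index e (es t))) (tg_label (G w) e)]
  else set0.

Let FP k t c : measurable (@F k t c) /\ (P (@F k t c) <= ((p / M.+1%:R) ^+ k.+1)%:E)%E.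
Proof.
have [/andP[p0 p1] _ _ _] := HG.
rewrite /F; case: ifP => ut; last first.
  by split => //; rewrite measure0 lee_fin exprn_ge0// divr_ge0.
have [||||] // := @edges_present_prob _ _ _ _ _ _ _ HG (es t)
  (fun e => cell (nth ord0 c (index e (es t)))) (fun=> M.+1%:R^-1).
- exact: uniq_path_edges.
- by move=> e; apply: card_path_edges.
- by move=> e; apply: measurable_itv.
- by move=> e; apply: uniform_cell.
move=> mF ->; split => //; rewrite lee_fin le_eqVlt; apply/orP; left; apply/eqP.
by rewrite big_const_seq count_predT size_pairmap size_rcons size_tuple iter_mulr_1.
Qed.

(** Labels outside [[0, 1[], in particular [1], lie in no cell; they are set aside as a null
    event. *)
Let null : set T := [set w | exists2 e, e \in enum [set e : {set 'I_n} | #|e| == 2]%SET &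
  (e \in tg_edges (G w) /\ (~` `[0, 1[) (tg_label (G w) e))].

Let nullP : measurable null /\ (P null <= 0)%E.
Proof.
pose B (e : {set 'I_n}) : set T :=
  if #|e| == 2 then [set w | forall e', e' \in [:: e] ->
    e' \in tg_edges (G w) /\ (~` `[0, 1[) (tg_label (G w) e')]
  else set0.
have BP e : measurable (B e) /\ (P (B e) <= 0%:E)%E.
  rewrite /B; case: ifP => [/eqP e2|]; last by rewrite measure0.
  have [||||] // := @edges_present_prob _ _ _ _ _ _ _ HG [:: e] (fun=> ~` `[0, 1[) (fun=> 0).
  - by move=> e'; rewrite inE => /eqP ->.
  - by move=> _; apply: measurableC.
  - by move=> _; apply: uniform01_itvco01C.
  by move=> mB ->; rewrite big_seq1 mulr0.
have -> : null = [set w | exists2 e, e \in enum [set e : {set 'I_n} | #|e| == 2]%SET & B e w].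
  apply/seteqP; split=> w [e ein He]; exists e => //; move: ein; rewrite mem_enum inE => e2.
    by rewrite /B e2 /= => e'; rewrite inE => /eqP ->.
  by move: He; rewrite /B e2 /= => /(_ e); rewrite inE eqxx; apply.
split; first by apply: measurable_exists2 => e; case: (BP e).
apply: le_trans (@measure_exists2_leE _ _ _ P _ _ B (fun=> 0) _ _) _.
- by move=> e; case: (BP e).
- by move=> e _; case: (BP e).
- by rewrite big1.
Qed.

Let X k t w := exists2 c : k.+1.-tuple 'I_M.+1,
  c \in enum [set c : k.+1.-tuple 'I_M.+1 | sorted leq (map val c)]%SET & @F k t c w.
Let Y k w := exists2 t : k.-tuple 'I_n, t \in enum {: k.-tuple 'I_n} & X t w.

Let path_sub : v <> u -> [set w | has_temporal_path (G w) v u] `<=`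
  null `|` [set w | exists2 k, k \in iota 0 n & Y k w].
Proof.
move=> vu w [s [ps ls us ss]].
have [|nnull] := pselect (null w); [by left|right => /=].
(* As [v] and [u] differ, the path is nonempty and ends in [u]; [s'] holds its inner vertices. *)
case: (lastP s) ls ps us ss => [/= vu'|s' y]; first by case: vu.
rewrite last_rcons => -> ps us ss.
exists (size s').
  rewrite mem_iota add0n leq0n /=.
  have := max_card (mem (v :: rcons s' u)); rewrite (card_uniqP us) card_ord /= size_rcons.
  exact: ltnW.
pose k := size s'; exists (in_tuple s'); first by rewrite mem_enum.
set es' := path_edges v (rcons s' u).
have esE : es (in_tuple s') = es' by [].
have in_edges e : e \in es' -> e \in tg_edges (G w).
  rewrite /es'; move: ps; move: (rcons s' u) (v); elim=> //= b r IH a /andP[ab pr].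
  by rewrite inE => /orP[/eqP ->//|]; apply: IH.
have lab01 e : e \in es' -> 0 <= tg_label (G w) e < 1.
  move=> ein; apply: contrapT => lab01; apply: nnull; exists e.
    by rewrite mem_enum inE (card_path_edges us ein).
  by split; [exact: in_edges|rewrite /= in_itv].
have sz : size (map (fun e => cell_of (tg_label (G w) e)) es') == k.+1.
  by rewrite size_map /es' size_pairmap size_rcons.
exists (Tuple sz).
  rewrite mem_enum inE /= -map_comp.
  have : sorted <=%R (map (tg_label (G w)) es').
    suff -> : map (tg_label (G w)) es' =
        pairmap (fun a b => tg_label (G w) [set a; b]%SET) v (rcons s' u) by [].
    by rewrite /es'; move: (rcons s' u) (v); elim=> //= b r IH a; rewrite IH.
  have : {in es', forall e, 0 <= tg_label (G w) e < 1} by [].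
  elim: (es') => // e [//|e' r] IH lab /= /andP[ee' sr].
  have ein : e \in [:: e, e' & r] by rewrite mem_head.
  have e'in : e' \in [:: e, e' & r] by rewrite !inE eqxx orbT.
  rewrite cell_of_le ?lab//=; apply: IH => // e0 e0r.
  by apply: lab; rewrite inE e0r orbT.
rewrite /F us => e; rewrite esE => ein; split; first exact: in_edges.
rewrite /= (nth_map e) ?index_mem// nth_index//.
by apply: cell_ofP; apply: lab01.
Qed.

(** Temporal order forces weakly increasing cells. There are [n ^ k] choices of inner vertices, the
    binomial counts the weakly increasing cell sequences, and each edge costs a factor
    [p / M.+1]. *)
Lemma temporal_path_union_bound : v <> u ->
  (P [set w | has_temporal_path (G w) v u] <=
   (\sum_(k <- iota 0 n) n%:R ^+ k *
      ('C(k.+1 + M, k.+1)%:R * (p / M.+1%:R) ^+ k.+1))%:E)%E.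
Proof.
move=> vu.
have mX k (t : k.-tuple 'I_n) : measurable (X t).
  by apply: (@measurable_exists2 _ _ _ _ (@F k t)) => c; case: (FP t c).
have mY k : measurable (Y k) by apply: (@measurable_exists2 _ _ _ _ (@X k)) => t.
have mZ : measurable [set w | exists2 k, k \in iota 0 n & Y k w].
  exact: measurable_exists2.
apply: (@le_trans _ _ (P (null `|` [set w | exists2 k, k \in iota 0 n & Y k w]))).
  apply: le_measure (path_sub vu); rewrite inE.
    exact: (measurable_has_temporal_path HG).
  by apply: measurableU => //; case: nullP.
apply: le_trans (measureU2 P _ mZ) _; first by case: nullP.
rewrite -[leRHS]add0e; apply: leeD; first by case: nullP.
apply: measure_exists2_leE => // k _.
apply: (@le_trans _ _ (\sum_(t <- enum {: k.-tuple 'I_n})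
   ('C(k.+1 + M, k.+1)%:R * (p / M.+1%:R) ^+ k.+1))%:E).
  apply: measure_exists2_leE => // t _.
  apply: le_trans (@measure_exists2_leE _ _ _ P _ _ (@F k t) (fun=> (p / M.+1%:R) ^+ k.+1) _ _) _.
  - by move=> c; case: (FP t c).
  - by move=> c _; case: (FP t c).
  by rewrite big_enum sumr_const card_sorted_tuples mulr_natl.
by rewrite lee_fin big_enum sumr_const card_tuple card_ord -natrX [leRHS]mulr_natl.
Qed.

End first_moment.

(** With [M = n * n], the binomial is at most [(M + 1 + n) ^ (k + 1) / (k + 1)!], so the sum is an
    exponential series at [a], divided by [n]. The excess of [a] over [n p] is
    [n p * n / (n ^ 2 + 1) <= 1], whence the [+ 1]. *)
Lemma temporal_path_prob_le (R : realType) (n : nat) (p : R) (d : measure_display)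
    (T : measurableType d) (P : probability T R) (G : T -> temporal_graph R n)
    (v u : 'I_n) : is_Fnp p P G -> v <> u ->
  (P [set w | has_temporal_path (G w) v u] <= (expR (n%:R * p + 1) / n%:R)%:E)%E.
Proof.
move=> HG vu; have [/andP[p0 p1] _ _ _] := HG.
have n0 : (0 < n)%N by case: n v {u vu G HG} => // -[].
have nR0 : 0 < n%:R :> R by rewrite ltr0n.
apply: le_trans (temporal_path_union_bound HG (n * n) vu) _; rewrite lee_fin.
set M := (n * n)%N; have M0 : 0 < M.+1%:R :> R by rewrite ltr0n.
pose a : R := n%:R * p * ((M.+1%:R + n%:R) / M.+1%:R).
have a0 : 0 <= a by rewrite !mulr_ge0// ?invr_ge0 ?addr_ge0// ltW.
apply: (@le_trans _ _ (expR a / n%:R)); last first.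
  rewrite ler_pM2r ?invr_gt0// ler_expR /a.
  rewrite (_ : _ / M.+1%:R = 1 + n%:R / M.+1%:R); last by field; rewrite gt_eqF.
  rewrite mulrDr mulr1 lerD2l mulrA ler_pdivrMr// mul1r.
  apply: (@le_trans _ _ (n%:R * n%:R)); last by rewrite -natrM ler_nat.
  by rewrite mulrAC ler_piMr// mulr_ge0// ltW.
apply: (@le_trans _ _ ((\sum_(k <- iota 0 n) a ^+ k.+1 / k.+1`!%:R) / n%:R)); last first.
  by rewrite ler_pM2r ?invr_gt0// sum_pow_fact_le_expR.
rewrite mulr_suml big_seq [leRHS]big_seq; apply: ler_sum => k.
rewrite mem_iota add0n leq0n /= => kn.
have f0 : 0 < k.+1`!%:R :> R by rewrite ltr0n fact_gt0.
have binle : 'C(k.+1 + M, k.+1)%:R <= (M.+1%:R + n%:R) ^+ k.+1 / k.+1`!%:R :> R.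
  rewrite ler_pdivlMr// -natrM bin_ffact -natrD -natrX ler_nat.
  apply: leq_trans (ffact_le_expn _ _) _; rewrite leq_exp2r//.
  by rewrite addSn addnC addSn ltnS leq_add2l ltnW.
rewrite (_ : _ / n%:R = n%:R ^+ k * (((M.+1%:R + n%:R) ^+ k.+1 / k.+1`!%:R) *
    (p / M.+1%:R) ^+ k.+1)).
  apply: ler_wpM2l; first by rewrite exprn_ge0// ltW.
  by apply: ler_wpM2r => //; rewrite exprn_ge0// divr_ge0.
rewrite /a !exprMn !exprVn (exprS n%:R); field.
by rewrite !gt_eqF// exprn_gt0.
Qed.

Lemma sorted_rcons_le (R : realType) (l : seq R) (c : R) :
  sorted <=%R l -> all (fun x => x <= c) l -> sorted <=%R (rcons l c).
Proof.
case: l => //= x l pl /andP[xc lc]; rewrite rcons_path pl /=.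
by have /predU1P[->//|/(allP lc)] := mem_last x l.
Qed.

(** * From reachability through windows to temporal paths *)

Section windows_path.
Variables (R : realType) (n M : nat) (g : temporal_graph R n) (a : nat -> R).
Variables (D : {set 'I_n} -> option 'I_M) (v : 'I_n).
Hypothesis a_mono : {homo a : i j / (i <= j)%N >-> i <= j}.
Hypothesis DP : forall e i, D e = Some i ->
  e \in tg_edges g /\ a i <= tg_label g e < a i.+1.

Let labels (s : seq 'I_n) := pairmap (fun x y => tg_label g [set x; y]%SET) v s.

(** Invariant of the hops: since the path stays in [S], a new vertex can be appended without
    repetition, and since its labels are below [t], a label from a later window keeps it sorted. *)
Definition reached_before (t : R) (S : {set 'I_n}) := forall y, y \in S ->
  exists s, [/\ path (tg_adj g) v s, last v s = y, uniq (v :: s),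
    sorted <=%R (labels s) & {subset v :: s <= S} /\ all (fun x => x < t) (labels s)].

Lemma reached_before_spread t S (i : 'I_M) : t <= a i -> reached_before t S ->
  reached_before (a i.+1) (spread S (fun e => D e == Some i)).
Proof.
move=> ti HS y; rewrite mem_spread; have [yS _|yS /=] := boolP (y \in S).
  have [s [ps ls us ss [sS st]]] := HS _ yS; exists s; split => //; split.
    by move=> z /sS; apply: (fintype.subsetP (sub_spread _ _)).
  apply: sub_all st => x xt; apply: lt_le_trans xt (le_trans ti _).
  exact: a_mono.
move=> /existsP[x /andP[xS /eqP Dxy]].
have [s [ps ls us ss [sS st]]] := HS _ xS; exists (rcons s y).
have [xyE /andP[al la]] := DP Dxy.
have labE : labels (rcons s y) = rcons (labels s) (tg_label g [set x; y]%SET).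
  by rewrite /labels -cats1 pairmap_cat ls /= cats1.
split.
- by rewrite rcons_path ps ls.
- by rewrite last_rcons.
- suff : uniq (rcons (v :: s) y) by [].
  by rewrite rcons_uniq us andbT; apply: contra yS => /sS.
- rewrite labE; apply: sorted_rcons_le => //; apply: sub_all st => z /ltW zt.
  exact: le_trans zt (le_trans ti al).
split.
  move=> z; rewrite -[_ :: _]/(rcons (v :: s) y) mem_rcons inE mem_spread => /orP[/eqP ->|/sS ->//].
  by apply/orP; right; apply/existsP; exists x; rewrite xS Dxy /=.
rewrite labE all_rcons la /=; apply: sub_all st => z zt.
exact: lt_le_trans zt (le_trans ti (a_mono (leqnSn _))).
Qed.

Lemma reached_before_reach (s : seq 'I_M) t S : (forall i, i \in s -> t <= a i) ->
  sorted ltn (map val s) -> reached_before t S ->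
  exists t', reached_before t' (reach s S D).
Proof.
elim: s t S => [|i s IH] t S ts ss HS; first by exists t.
apply: (IH (a i.+1)).
- move=> j js; apply: a_mono.
  move: ss => /=; rewrite (path_sortedE ltn_trans) => /andP[/allP + _].
  by apply; exact: map_f.
- by move: ss => /= /path_sorted.
- by apply: reached_before_spread HS; apply: ts; rewrite mem_head.
Qed.

Lemma temporal_path_of_reach u : u \in reach (enum 'I_M) [set v]%SET D ->
  has_temporal_path g v u.
Proof.
have HS : reached_before (a 0%N) [set v]%SET.
  move=> y; rewrite inE => /eqP ->; exists [::]; split => //; split => // z.
  by rewrite !inE.
have [||t' H] := reached_before_reach (s := enum 'I_M) _ _ HS.
- by move=> i _; apply: a_mono.
- by rewrite val_enum_ord iota_ltn_sorted.
by move=> /H[s [ps ls us ss _]]; exists s.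
Qed.

End windows_path.

Section windows_law.
Variables (R : realType) (n : nat) (p : R) (d : measure_display).
Variables (T : measurableType d) (P : probability T R) (G : T -> temporal_graph R n).
Hypothesis HG : is_Fnp p P G.
Variables (I : finType) (W : I -> set R) (wt : I -> R).
Let U := uniform_prob (@ltr01 R).
Hypothesis mW : forall i, measurable (W i).
Hypothesis tW : forall i j x, W i x -> W j x -> i = j.
Hypothesis UW : forall i, U (W i) = (wt i)%:E.

(** [None] covers both an absent pair and an edge whose label lies in no window. *)
Definition window_of (w : T) : {ffun {set 'I_n} -> option I} :=
  [ffun e => if e \in tg_edges (G w) then [pick i | `[< W i (tg_label (G w) e) >]] else None].

Lemma window_ofP w e i : window_of w e = Some i ->
  e \in tg_edges (G w) /\ W i (tg_label (G w) e).
Proof.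
by rewrite ffunE; case: ifP => // _; case: pickP => // j /asboolP Wj [<-].
Qed.

Let outside : set R := ~` [set x | exists2 i, i \in enum I & W i x].

Let U_outside : U outside = (1 - \sum_i wt i)%:E.
Proof.
transitivity (1 - U [set x | exists2 i, i \in enum I & W i x])%E.
  apply: (@probability_setC _ _ _ (uniform_prob (@ltr01 R))).
  exact: measurable_exists2.
have -> : U [set x | exists2 i, i \in enum I & W i x] =
    (\sum_(i <- enum I) (wt i)%:E)%E.
  rewrite -(eq_bigr _ (fun i _ => UW i)).
  by apply: (@measure_exists2 _ _ _ (uniform_prob (@ltr01 R))); rewrite ?enum_uniq.
by rewrite sumEFin big_enum.
Qed.

(** A pair is recorded in window [i] with probability [p * wt i], and not at all with probability
    [(1 - p) + p * (1 - \sum_i wt i)]: these are the weights of [single]. *)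
Lemma window_of_law (f : {ffun {set 'I_n} -> option I}) :
  measurable [set w | window_of w = f] /\
  P [set w | window_of w = f] =
  (\prod_e single (fun i => p * wt i) (enum I) e (f e))%:E.
Proof.
case: (boolP [forall e : {set 'I_n}, (#|e| != 2) ==> (f e == None)]); last first.
  rewrite negb_forall => /existsP[e]; rewrite negb_imply => /andP[e2 fe].
  have -> : [set w | window_of w = f] = set0.
    apply/seteqP; split=> w //= wf; move: fe; rewrite -wf.
    case E: (window_of w e) => [i|//]; have [/tg_edgesP e2' _] := window_ofP E.
    by rewrite e2' in e2.
  split => //; rewrite measure0 (bigD1 e)//= /single (negPf e2) (negPf fe).
  by rewrite mul0r.
move=> /forallP fN.
pose B e := if f e is Some i then W i else outside.
have mout : measurable outside by apply: measurableC; exact: measurable_exists2.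
have mB e : measurable (B e) by rewrite /B; case: (f e).
have -> : [set w | window_of w = f] = pair_event G (fun e => f e == None) B.
  apply/seteqP; split=> w /=.
    move=> wf e e2; rewrite /B -wf; case E: (window_of w e) => [i|].
      by have [-> ] := window_ofP E.
    case: ifP => // eE [i _ Wi]; move: E; rewrite ffunE eE.
    by case: pickP => // /(_ i) /asboolP.
  move=> H; apply/ffunP => e; rewrite ffunE; case: ifP => eE; last first.
    have [/eqP e2|e2] := boolP (#|e| == 2).
      by have := H e e2; rewrite eE => /eqP.
    by have := fN e; rewrite e2 => /eqP.
  have := H e (tg_edgesP eE); rewrite eE /B; case: (f e) => [i|] Wi.
    case: pickP => [j /asboolP Wj|/(_ i) /asboolP//].
    by congr Some; apply: tW Wj Wi.
  case: pickP => // j /asboolP Wj; exfalso; apply: Wi; exists j => //.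
  by rewrite mem_enum.
split; first exact: (measurable_pair_event HG).
rewrite (pair_event_prob HG _ (b := fun e => if f e is Some i then wt i else 1 - \sum_i wt i))//.
  congr EFin; rewrite big_mkcond; apply: eq_bigr => e _.
  rewrite /single; case: ifPn => e2; last by have := fN e; rewrite e2 /= => ->.
  case: (f e) => [i|] /=; first by rewrite mem_enum mul1r mulr0 addr0.
  by rewrite big_enum /= -mulr_sumr; ring.
by move=> e; rewrite /B; case: (f e) => [i|]; [exact: UW|exact: U_outside].
Qed.

End windows_law.

(** Consecutive windows of lengths [h / p] ([m] times) and [d / p] fit into [[0, 1]] exactly when
    [h *+ m + d <= p]. An edge being present with probability [p], a pair then falls into them with
    densities [h] and [d]. *)
Lemma fresh_le_temporal_path_prob (R : realType) (n : nat) (p : R) (dd : measure_display)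
    (T : measurableType dd) (P : probability T R) (G : T -> temporal_graph R n)
    (v u : 'I_n) (m : nat) (h d : R) : is_Fnp p P G ->
  0 <= h -> 0 <= d -> 0 < p -> h *+ m + d <= p ->
  ((fresh u (rcons (nseq m h) d) [set v]%SET)%:E <=
   P [set w | has_temporal_path (G w) v u])%E.
Proof.
move=> HG h0 d0 p0 hdp; have [/andP[_ p1] _ _ _] := HG.
(* Left ends of the windows, continued as a constant beyond [m.+1] so that [a] is monotone on all of
   [nat]. *)
pose a (i : nat) : R := ((minn i m)%:R * h + (if (m < i)%N then d else 0)) / p.
have a_mono : {homo a : i j / (i <= j)%N >-> i <= j}.
  move=> i j ij; rewrite /a ler_pM2r ?invr_gt0//; apply: lerD.
    by rewrite ler_wpM2r// ler_nat leq_min geq_minr andbT (leq_trans (geq_minl _ _)).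
  by case: ifP => mi; case: ifP => // mj; move: (leq_trans mi ij); rewrite mj.
have a0 : 0 <= a 0%N by rewrite /a min0n mul0r addr0 mul0r.
have a1 i : a i <= 1.
  rewrite /a ler_pdivrMr// mul1r; apply: le_trans hdp; apply: lerD; last by case: ifP.
  by rewrite -(mulr_natl h m) ler_wpM2r// ler_nat geq_minr.
pose W (i : 'I_m.+1) : set R := `[a i, a i.+1[.
pose wt (i : 'I_m.+1) := a i.+1 - a i.
have mW i : measurable (W i) by exact: measurable_itv.
have WE i x : W i x = (a i <= x < a i.+1) :> Prop by rewrite /W /= in_itv.
have tW i j x : W i x -> W j x -> i = j.
  rewrite !WE => /andP[ai ai1] /andP[aj aj1]; apply/val_inj/eqP; rewrite eqn_leq.
  apply/andP; split; rewrite leqNgt; apply/negP => /a_mono.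
    by rewrite leNgt (le_lt_trans ai aj1).
  by rewrite leNgt (le_lt_trans aj ai1).
have UW i : uniform_prob (@ltr01 R) (W i) = (wt i)%:E.
  by apply: uniform01_itvco => //; [apply: le_trans a0 (a_mono _ _ _)|exact: a_mono].
have wtE : map (fun i => p * wt i) (enum 'I_m.+1) = rcons (nseq m h) d.
  have pne : p != 0 by rewrite gt_eqF.
  rewrite enum_ordSr map_rcons -map_comp; congr rcons.
    rewrite (eq_map (g := fun=> h)).
      by rewrite -[in RHS](size_enum_ord m); elim: (enum 'I_m) => //= i s ->.
    move=> i /=; rewrite /wt /a /= !(minn_idPl _) ?ltn_ord ?(ltnW (ltn_ord i))//.
    rewrite ltnS leqNgt ltn_ord ltnNge (ltnW (ltn_ord i)) /= -natr1.
    by field.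
  rewrite /wt /a /= minnn ltnn ltnSn (minn_idPr (leqnSn m)).
  by field.
have h'0 i : 0 <= p * wt i by rewrite mulr_ge0 ?(ltW p0)// subr_ge0 a_mono.
have hsum : \sum_(i <- enum 'I_m.+1) p * wt i <= 1.
  rewrite -(big_map _ xpredT id) wtE big_rcons/= big_nseq.
  by rewrite iter_addr_0 (le_trans hdp).
have := fresh_le_single u h'0 [set v]%SET (enum_uniq 'I_m.+1) hsum.
rewrite wtE -lee_fin => /le_trans; apply.
have mwin f := (window_of_law HG mW tW UW f).1.
have Pwin f := (window_of_law HG mW tW UW f).2.
pose hit := enum [set f : {ffun {set 'I_n} -> option 'I_m.+1} |
  u \in reach (enum 'I_m.+1) [set v]%SET f]%SET.
apply: (@le_trans _ _ (P [set w | exists2 f, f \in hit & window_of G W w = f])).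
  rewrite (@measure_exists2 _ _ _ P _ _ (fun f w => window_of G W w = f)) ?enum_uniq//; last first.
    by move=> f f' w -> ->.
  rewrite (eq_bigr _ (fun f _ => Pwin f)) sumEFin lee_fin big_enum /= [leRHS]big_mkcond.
  by apply/le_of_eq/eq_bigr => f _; rewrite inE; case: (u \in _); rewrite ?mulr1 ?mulr0.
apply: le_measure; rewrite ?inE.
- exact: (@measurable_exists2 _ _ _ _ (fun f w => window_of G W w = f)).
- exact: (measurable_has_temporal_path HG).
move=> w [f]; rewrite mem_enum inE => + wf; rewrite -wf.
apply: (@temporal_path_of_reach _ _ _ _ a) => // e i /window_ofP[eE].
by rewrite WE.
Qed.

(** * The two sides of the threshold *)

Section threshold.
Variables (R : realType) (n : nat).
Hypothesis ln_ge : 32 ^+ 5 <= ln n%:R :> R.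
Let L : R := ln n%:R.
(** The fifth root turns the real powers [1] and [4 / 5] of [ln n] into natural powers of [x]. *)
Let x : R := L `^ 5^-1.

Lemma n_gt0_of_ln : (0 < n)%N.
Proof.
rewrite lt0n; apply: contraTneq ln_ge => ->; rewrite ln0// -ltNge.
by rewrite exprn_gt0.
Qed.

Let L0 : 0 <= L. Proof. by apply: le_trans ln_ge; rewrite exprn_ge0. Qed.

Lemma root5_exp k : x ^+ k = L `^ (k%:R / 5).
Proof. by rewrite -powR_mulrn ?powR_ge0// -powRrM mulrC. Qed.

Lemma root5E : ln n%:R = x ^+ 5.
Proof. by rewrite root5_exp divff// powRr1. Qed.

Lemma root5_ge (c : R) : 0 <= c -> c ^+ 5 <= ln n%:R -> c <= x.
Proof.
by move=> c0; rewrite root5E ler_pXn2r// nnegrE powR_ge0.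
Qed.

Lemma eps_nE : eps_n R n = 3 * x ^+ 4 / n%:R.
Proof. by rewrite /eps_n root5_exp. Qed.

Variables (p : R) (v u : 'I_n) (d : measure_display) (T : measurableType d).
Variables (P : probability T R) (G : T -> temporal_graph R n).
Hypotheses (vu : v <> u) (HG : is_Fnp p P G).

Let nR0 : 0 < n%:R :> R. Proof. by rewrite ltr0n n_gt0_of_ln. Qed.
Let x32 : 32 <= x. Proof. exact: root5_ge. Qed.
Let L_gt0 : 0 < L. Proof. by apply: lt_le_trans ln_ge; rewrite exprn_gt0. Qed.

(** Here [n p + 1 - ln n < 1 - 3 * x ^+ 4], which is at most [- x ^+ 4], so the first moment is at
    most [expR (- x ^+ 4) <= 2 / x ^+ 8], well below [6 / x ^+ 5]. *)
Lemma below_threshold : p < ln n%:R / n%:R - eps_n R n ->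
  ((1 - 6 / ln n%:R)%:E <= P [set w | ~ has_temporal_path (G w) v u])%E.
Proof.
rewrite eps_nE -mulrBl ltr_pdivlMr// => pn.
have mA := measurable_has_temporal_path HG v u.
rewrite (_ : [set w | ~ _] = ~` [set w | has_temporal_path (G w) v u])//.
rewrite probability_setC// EFinB leeB//.
apply: le_trans (temporal_path_prob_le HG vu) _; rewrite lee_fin.
have nE : n%:R = expR L by rewrite /L lnK// posrE.
have -> : n%:R^-1 = expR (- L) by rewrite expRN -nE.
rewrite -expRD.
have x4 : 1 <= x ^+ 4 by rewrite exprn_ege1//; apply: le_trans x32; rewrite ler1n.
apply: (@le_trans _ _ (expR (- x ^+ 4))).
  by rewrite ler_expR; move: pn; rewrite -/L; lra.
rewrite expRN -[leRHS]invrK lef_pV2 ?posrE ?expR_gt0 ?invr_gt0 ?divr_gt0//.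
rewrite invf_div; apply: le_trans (expR_ge_pow 2 _); last by rewrite exprn_ge0// powR_ge0.
rewrite root5E -exprM (_ : 2`! = 2)//= (exprD x 5 3).
have x3 : 1 <= x ^+ 3 by rewrite exprn_ege1//; apply: le_trans x32; rewrite ler1n.
have x5 : x ^+ 5 <= x ^+ 5 * x ^+ 3 by rewrite ler_peMr// exprn_ge0// powR_ge0.
have x50 : 0 <= x ^+ 5 by rewrite exprn_ge0// powR_ge0.
by lra.
Qed.

(** The assumption leaves just enough room for the [n] short windows and the last one of
    [fresh_fail_le_ln], whose failure bound is [2 / ln n]. *)
Lemma above_threshold : p > ln n%:R / n%:R + eps_n R n ->
  ((1 - 6 / ln n%:R)%:E <= P [set w | has_temporal_path (G w) v u])%E.
Proof.
rewrite eps_nE -mulrDl ltr_pdivrMr// => pn.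
have S0 : (0 < #|[set v]%SET|)%N by rewrite cards1.
have cardn : #|'I_n| = n by rewrite card_ord.
have := @fresh_fail_le_ln R 'I_n u [set v]%SET x x32; rewrite /= cardn.
move=> /(_ root5E n_gt0_of_ln S0)[/andP[d0 _] /andP[h0 _] fail].
apply: (@le_trans _ _ (1 - 2 / ln n%:R)%:E).
  by rewrite lee_fin lerD2l lerN2 ler_pM2r ?invr_gt0// ler_nat.
apply: le_trans (@fresh_le_temporal_path_prob _ _ _ _ _ _ _ v u n _ _ HG h0 d0 _ _).
- by rewrite lee_fin; lra.
- rewrite -(pmulr_lgt0 _ nR0); apply: lt_trans pn; rewrite root5E.
  rewrite ltr_pwDl ?exprn_gt0 ?mulr_ge0 ?exprn_ge0 ?powR_ge0//.
  by apply: lt_le_trans x32.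
- rewrite -[X in X + _]mulr_natr (_ : _ * n%:R + _ = (x ^+ 5 + 3 * x ^+ 4) / n%:R); last first.
    by field; rewrite gt_eqF.
  by rewrite ler_pdivrMr// -root5E ltW.
Qed.

End threshold.

Lemma ln_nat_near (R : realType) (c : R) : \forall n \near \oo, c <= ln n%:R.
Proof.
exists (Num.truncn (expR c)).+1 => //= n cn.
have n0 : 0 < n%:R :> R by rewrite ltr0n (leq_trans _ cn).
rewrite -[c]expRK ler_ln ?posrE ?expR_gt0//.
apply: ltW; apply: lt_le_trans (_ : (Num.truncn (expR c)).+1%:R <= _); last by rewrite ler_nat.
by have /andP[] := truncn_itv (expR_ge0 c).
Qed.

Theorem theorem5p1 (R : realType) :
  (forall v u : nat -> nat,
     (\forall n \near \oo, [/\ (v n < n)%N, (u n < n)%N & v n <> u n]) ->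
     sharp_threshold (fun n => ln n%:R / n%:R : R)
       (@pair_has_temporal_path R v u)) /\
  exists N : nat, forall n : nat, (N <= n)%N ->
    forall p : R, 0 <= p <= 1 ->
    forall v u : 'I_n, v <> u ->
    forall (d : measure_display) (T : measurableType d) (P : probability T R)
      (G : T -> temporal_graph R n), is_Fnp p P G ->
    (p < ln n%:R / n%:R - eps_n R n ->
       ((1 - 6 / ln n%:R)%:E <= P [set w | ~ has_temporal_path (G w) v u])%E) /\
    (p > ln n%:R / n%:R + eps_n R n ->
       ((1 - 6 / ln n%:R)%:E <= P [set w | has_temporal_path (G w) v u])%E).
Proof.
split; last first.
  have [N _ HN] := ln_nat_near (32 ^+ 5 : R).
  exists N => n /HN /= Ln p _ v u vu d T P G HG.
  by split; [exact: below_threshold|exact: above_threshold].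
move=> v u vu eps eps0.
have pairE n (G : temporal_graph R n) (vn : (v n < n)%N) (un : (u n < n)%N) :
    pair_has_temporal_path v u G <-> has_temporal_path G (Ordinal vn) (Ordinal un).
  split=> [[x [y [xv yu]]]|H]; last by exists (Ordinal vn), (Ordinal un).
  by rewrite (_ : x = Ordinal vn) 1?(_ : y = Ordinal un)//; apply: val_inj.
(* The ratio of [eps_n] to [ln n / n] is [3 / x], which tends to [0]; hence [(1 - eps)] and
   [(1 + eps)] times [ln n / n] eventually leave the window of the quantitative bounds. *)
have large (delta : R) : 0 < delta -> \forall n \near \oo,
    [/\ (32 ^+ 5 : R) <= ln n%:R, 6 / ln n%:R <= delta & eps_n R n < eps * (ln n%:R / n%:R)].
  move=> delta0; have e4 : 0 < 4 / eps by rewrite divr_gt0.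
  near=> n; have Ln : (32 ^+ 5 : R) <= ln n%:R by near: n; exact: ln_nat_near.
  have L0 : 0 < ln n%:R :> R by apply: lt_le_trans Ln; rewrite exprn_gt0.
  have nR0 : 0 < n%:R :> R by rewrite ltr0n (n_gt0_of_ln Ln).
  split => //.
    rewrite ler_pdivrMr// -ler_pdivrMl//; near: n; exact: ln_nat_near.
  rewrite eps_nE// mulrA ltr_pM2r ?invr_gt0//.
  have := root5E Ln; set x := ln n%:R `^ 5^-1 => ->.
  (* Taking [4] instead of [3] gives the strict inequality. *)
  have x4 : 4 / eps <= x.
    apply: root5_ge => //; first exact: ltW.
    by near: n; exact: ln_nat_near.
  have x0 : 0 < x by rewrite powR_gt0.
  rewrite (_ : eps * x ^+ 5 = eps * x * x ^+ 4); last by ring.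
  rewrite ltr_pM2r ?exprn_gt0// mulrC; move: x4; rewrite ler_pdivrMr//.
  by apply: lt_le_trans; rewrite ltr_nat.
split=> delta delta0.
  near=> n => d T P G HG; have [Ln Ld Le] : [/\ (32 ^+ 5 : R) <= ln n%:R,
      6 / ln n%:R <= delta & eps_n R n < eps * (ln n%:R / n%:R)] by near: n; exact: large.
  have [vn un vun] : [/\ (v n < n)%N, (u n < n)%N & v n <> u n] by near: n.
  rewrite (_ : [set w | ~ _] =
      [set w | ~ has_temporal_path (G w) (Ordinal vn) (Ordinal un)]); last first.
    by apply/seteqP; split=> w /=; rewrite (pairE _ _ vn un).
  apply: le_trans (below_threshold Ln _ HG _).
  - by rewrite lee_fin lerD2l lerN2.
  - by case.
  - by rewrite mulrBl mul1r ltrD2l ltrN2.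
near=> n => d T P G HG; have [Ln Ld Le] : [/\ (32 ^+ 5 : R) <= ln n%:R,
    6 / ln n%:R <= delta & eps_n R n < eps * (ln n%:R / n%:R)] by near: n; exact: large.
have [vn un vun] : [/\ (v n < n)%N, (u n < n)%N & v n <> u n] by near: n.
rewrite (_ : [set w | _] = [set w | has_temporal_path (G w) (Ordinal vn) (Ordinal un)]); last first.
  by apply/seteqP; split=> w /=; rewrite (pairE _ _ vn un).
apply: le_trans (above_threshold Ln (Ordinal vn) (Ordinal un) HG _).
- by rewrite lee_fin lerD2l lerN2.
- by rewrite mulrDl mul1r ltrD2l.
Unshelve. all: by end_near.
Qed.
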